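(* Let $I\subseteq(0,\infty)$ be an interval and let $f:I\to(0,\infty)$ be an operator geometrically convex function. Let $A,B\in B(H)^{++}$ with $\operatorname{Sp}(A),\operatorname{Sp}(B)\subseteq I$. Then $$f(A\sharp B)\leq \int_0^1 f(A\sharp_t B)\,\sharp\, f(A\sharp_{1-t}B)\,dt\leq f(A)\sharp f(B).$$
   Context: $H$ is a complex Hilbert space, $B(H)$ the $C^*$-algebra of bounded linear operators on $H$, and $\operatorname{Sp}(A)$ is the spectrum of $A$. $B(H)^{++}$ is the set of strictly positive operators, i.e. $A\in B(H)$ with $\langle Ax,x\rangle>0$ for all nonzero $x\in H$ (if moreover $\operatorname{Sp}(A)\subseteq(0,\infty)$, then $A$ is invertible). The order $\leq$ is the usual operator order on self-adjoint operators, and $f(A)$ is defined by the continuous functional calculus. For positive invertible $A,B$ and $t\in[0,1]$, the $t$-geometric mean is $A\sharp_t B=A^{1/2}(A^{-1/2}BA^{-1/2})^tA^{1/2}$, and $A\sharp B=A\sharp_{1/2}B$. If $\operatorname{Sp}(A),\operatorname{Sp}(B)\subseteq I$ then $\operatorname{Sp}(A\sharp_t B)\subseteq I$, so $f(A\sharp_t B)$ is defined. A continuous function $f:I\to(0,\infty)$ is operator geometrically convex if $f(A\sharp_t B)\leq f(A)\sharp_t f(B)$ for all $t\in[0,1]$ and all $A,B\in B(H)^{++}$ with $\operatorname{Sp}(A),\operatorname{Sp}(B)\subseteq I$. Integrals are of norm-continuous $B(H)$-valued functions of $t$. *)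

(* Defs.v *)
From HB Require Import structures.
From mathcomp Require Import all_boot all_order all_algebra.
From mathcomp Require Import complex.
From mathcomp Require Import all_classical all_reals all_analysis.
Import Order.TTheory GRing.Theory Num.Theory.
Import numFieldNormedType.Exports.

Set Implicit Arguments.
Unset Strict Implicit.
Unset Printing Implicit Defensive.

Local Open Scope classical_set_scope.
Local Open Scope ring_scope.
Local Open Scope complex_scope.

(* The inner product is linear in its first argument and conjugate-linear in
   its second one. *)
HB.mixin Record CompleteNormedModule_isHilbert (R : realType) H
    & CompleteNormedModule R[i] H := {
  hdot : {dot H for (@Num.conj R[i])} ;
  hdot_norm : forall x : H, hdot x x = `|x| ^+ 2 }.

#[short(type="hilbertType")]
HB.structure Definition Hilbert (R : realType) :=
  {H of CompleteNormedModule R[i] H & CompleteNormedModule_isHilbert R H}.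

Section BoundedOperators.
Context {R : realType} {H : normedModType R[i]}.

Definition bounded_op : {pred H -> H} := fun f =>
  `[< linear f /\ exists M : R, forall x, `|f x| <= M%:C * `|x| >].

Fact bounded_op_submod : submod_closed bounded_op.
Proof.
split.
  apply/asboolP; split=> [a x y|]; first by rewrite [RHS]addr0 scaler0.
  by exists 0 => x; rewrite [leLHS]normr0 mul0r.
move=> a f g /asboolP[fl [M fM]] /asboolP[gl [N gN]]; apply/asboolP; split.
  move=> b x y.
  rewrite -[LHS]/(a *: f (b *: x + y) + g (b *: x + y)).
  rewrite -[RHS]/(b *: (a *: f x + g x) + (a *: f y + g y)).
  by rewrite fl gl !scalerDr !scalerA (mulrC a b) addrACA.
exists (complex.Re `|a| * M + N) => x.
rewrite -[leLHS]/(`|a *: f x + g x|) rmorphD rmorphM mulrDl.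
rewrite (le_trans (ler_normD _ _))// lerD// normrZ -mulrA.
by rewrite [X in _ <= X * _]RRe_real ?normr_real// ler_wpM2l.
Qed.
HB.instance Definition _ := GRing.isSubmodClosed.Build R[i] (H -> H) bounded_op
  (GRing.submod_closed_semi bounded_op_submod).

Record bop := Bop { bop_fun :> H -> H ; _ : bop_fun \in bounded_op }.
HB.instance Definition _ := [isSub for bop_fun].
HB.instance Definition _ := [Choice of bop by <:].
HB.instance Definition _ := [SubChoice_isSubLmodule of bop by <:].

Implicit Types A B C : bop.

Fact bop_ext A B : A =1 B -> A = B.
Proof. by move=> AB; apply/val_inj/funext. Qed.

Fact bop_linear A : linear A.
Proof. by have /asboolP[] := valP A. Qed.

Fact bop_bounded A : exists M : R, forall x, `|A x| <= M%:C * `|x|.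
Proof. by have /asboolP[] := valP A. Qed.

Fact bop_id_subproof : idfun \in bounded_op.
Proof. by apply/asboolP; split=> //; exists 1 => x; rewrite mul1r. Qed.

Fact bop_comp_subproof A B : A \o B \in bounded_op.
Proof.
have [M AM] := bop_bounded A; have [N BN] := bop_bounded B.
apply/asboolP; split=> [a x y|]; first by rewrite /= !bop_linear.
exists (`|M| * N) => x; rewrite rmorphM -mulrA (le_trans (AM _))//=.
rewrite (@le_trans _ _ (`|M|%:C * `|B x|))//.
  by rewrite ler_wpM2r// lecR ler_norm.
by rewrite ler_wpM2l// lecR.
Qed.

Definition bop_id := Bop bop_id_subproof.
Definition bop_comp A B := Bop (bop_comp_subproof A B).

Fact bop_compA : associative bop_comp.
Proof. by move=> A B C; exact: bop_ext. Qed.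
Fact bop_comp1l : left_id bop_id bop_comp.
Proof. by move=> A; exact: bop_ext. Qed.
Fact bop_comp1r : right_id bop_id bop_comp.
Proof. by move=> A; exact: bop_ext. Qed.
Fact bop_compDl : left_distributive bop_comp +%R.
Proof. by move=> A B C; exact: bop_ext. Qed.
Fact bop_compDr : right_distributive bop_comp +%R.
Proof.
move=> A B C; apply: bop_ext => x.
by have /= := bop_linear A 1 (B x) (C x); rewrite !scale1r.
Qed.

(* The product of B(H) is composition. Only a possibly trivial ring, because
   H may be the zero space. *)
HB.instance Definition _ := GRing.Zmodule_isPzRing.Build bop
  bop_compA bop_comp1l bop_comp1r bop_compDl bop_compDr.

Definition opnorm A : R :=
  sup [set complex.Re `|A x| | x in [set x : H | `|x| <= 1]].

Fact opnorm_has_sup A :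
  has_sup [set complex.Re `|A x| | x in [set x : H | `|x| <= 1]].
Proof.
split; first by exists (complex.Re `|A 0|), 0 => //=; rewrite normr0.
have [M AM] := bop_bounded A; exists `|M| => _ [x /= x1 <-].
rewrite -lecR RRe_real ?normr_real// (le_trans (AM x))//.
rewrite (@le_trans _ _ (`|M|%:C * `|x|))//.
  by rewrite ler_wpM2r// lecR ler_norm.
by rewrite ler_piMr// lecR.
Qed.

Fact bop0 A : A 0 = 0.
Proof. by have := bop_linear A (-1) 0 0; rewrite scaler0 addr0 scaleN1r addNr. Qed.

Fact bopZ A a x : A (a *: x) = a *: A x.
Proof. by rewrite -[a *: x]addr0 bop_linear bop0 addr0. Qed.

Fact opnorm_bound A x : `|A x| <= (opnorm A)%:C * `|x|.
Proof.
have [->|x0] := eqVneq x 0; first by rewrite bop0 !normr0 mulr0.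
have nx : 0 < `|x| by rewrite normr_gt0.
rewrite -ler_pdivrMr//.
have -> : `|A x| / `|x| = `|A (`|x|^-1 *: x)|.
  by rewrite bopZ normrZ normfV normr_id mulrC.
rewrite -[leLHS]RRe_real ?normr_real// lecR.
apply: ub_le_sup; first exact: (opnorm_has_sup A).2.
by exists (`|x|^-1 *: x) => //=; rewrite normrZ normfV normr_id mulVf ?gt_eqF.
Qed.

Fact opnorm_le A (M : R) :
  (forall x, `|x| <= 1 -> `|A x| <= M%:C) -> opnorm A <= M.
Proof.
move=> AM; apply: ge_sup; first exact: (opnorm_has_sup A).1.
by move=> _ [x /= x1 <-]; rewrite -lecR RRe_real ?normr_real// AM.
Qed.

Fact opnorm_ge0 A : 0 <= opnorm A.
Proof.
rewrite (@le_trans _ _ (complex.Re `|A 0|))//; first by rewrite bop0 normr0.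
apply: ub_le_sup; first exact: (opnorm_has_sup A).2.
by exists 0 => //=; rewrite normr0.
Qed.

Fact opnormD A B : (opnorm (A + B))%:C <= (opnorm A)%:C + (opnorm B)%:C :> R[i].
Proof.
rewrite -rmorphD lecR; apply: opnorm_le => x x1.
rewrite rmorphD (le_trans (ler_normD (A x) (B x)))// lerD//;
  rewrite (le_trans (opnorm_bound _ _))// ler_piMr// lecR opnorm_ge0 //.
Qed.

Fact opnormZ_le a A : opnorm (a *: A) <= complex.Re `|a| * opnorm A.
Proof.
apply: opnorm_le => x x1.
rewrite -[leLHS]/`|a *: A x| normrZ rmorphM.
rewrite [X in _ <= X * _]RRe_real ?normr_real// ler_wpM2l//.
by rewrite (le_trans (opnorm_bound _ _))// ler_piMr// lecR opnorm_ge0.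
Qed.

Fact opnormZ a A : (opnorm (a *: A))%:C = `|a| * (opnorm A)%:C :> R[i].
Proof.
apply/le_anti/andP; split.
  rewrite -[X in _ <= X * _]RRe_real ?normr_real// -rmorphM lecR.
  exact: opnormZ_le.
have [->|a0] := eqVneq a 0; first by rewrite normr0 mul0r lecR opnorm_ge0.
have na : 0 < `|a| by rewrite normr_gt0.
rewrite -ler_pdivlMl// -normfV -[X in _ <= X * _]RRe_real ?normr_real//.
rewrite -rmorphM lecR -[X in opnorm X <= _]scale1r -(mulVf a0) -scalerA.
exact: opnormZ_le.
Qed.

Fact opnorm_eq0 A : (opnorm A)%:C = 0 :> R[i] -> A = 0.
Proof.
move=> A0; apply: bop_ext => x; apply/eqP; rewrite -normr_le0.
by have := opnorm_bound A x; rewrite A0 mul0r.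
Qed.

(* The scalars are R[i], so the norm, a real number, is seen as a complex one. *)
HB.instance Definition _ := Lmodule_isNormed.Build R[i] bop
  opnormD opnormZ opnorm_eq0.

Definition op_spectrum A : set R[i] :=
  [set z | ~ exists B, (A - z *: (1 : bop)) * B = 1 /\
                     B * (A - z *: (1 : bop)) = 1].

Definition op_horner (p : {poly R[i]}) A : bop :=
  \sum_(k < size p) p`_k *: A ^+ k.

(* Continuous functional calculus f(A), for A self-adjoint (so that op_spectrum A
   is real) and f continuous on op_spectrum A: the limit in norm of p(A), for
   polynomials p converging to f uniformly on op_spectrum A. *)
Definition is_cfc (f : R -> R) A X := forall e : R, 0 < e ->
  exists p : {poly R[i]},
    (forall x : R, op_spectrum A x%:C -> `|(f x)%:C - p.[x%:C]| <= e%:C) /\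
    `|X - op_horner p A| <= e%:C.

Definition cfc f A : bop := xget 0 (is_cfc f A).

Definition gmean (t : R) A B : bop :=
  let Ah := cfc (fun x => x `^ 2^-1) A in
  let Anh := cfc (fun x => x `^ (- 2^-1)) A in
  Ah * cfc (fun x => x `^ t) (Anh * B * Anh) * Ah.

End BoundedOperators.
Arguments bop {R} H.

Section RiemannIntegral.
Context {R : realType} {V : normedModType R[i]}.
Implicit Types (F : R -> V) (s : seq R) (xi : nat -> R).

(* For the partition a = s_0 < s_1 < ... < s_n = b of `[a, b], given as
   s = [:: s_1; ...; s_n] in the library's itv_partition, xi k is the tag of
   the subinterval from s_k to s_(k+1). *)
Definition tagged a s xi := forall k, (k < size s)%N ->
  nth 0 (a :: s) k <= xi k <= nth 0 s k.

Definition riemann_sum F a s xi : V :=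
  \sum_(k < size s) (nth 0 s k - nth 0 (a :: s) k)%:C *: F (xi k).

Definition is_rint F a b (J : V) := forall e : R, 0 < e ->
  exists2 d : R, 0 < d & forall s xi, itv_partition a b s -> tagged a s xi ->
    (forall k, (k < size s)%N -> nth 0 s k - nth 0 (a :: s) k < d) ->
    `|riemann_sum F a s xi - J| <= e%:C.

Definition rint F a b : V := xget 0 (is_rint F a b).

End RiemannIntegral.

Section HilbertOperators.
Context {R : realType} {H : hilbertType R}.
Implicit Types (A B : bop H) (I : interval R).

Definition strictly_positive A := forall x : H, x != 0 -> 0 < hdot (A x) x.

(* In the order of R[i] nonnegative numbers are real, so on a complex space this
   makes B - A self-adjoint as well as positive. *)
Definition op_le A B := forall x : H, 0 <= hdot ((B - A) x) x.

Definition spectrum_in I A := op_spectrum A `<=` [set x%:C | x in [set` I]].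

Definition op_geom_convex I (f : R -> R) :=
  [/\ {within [set` I], continuous f},
      forall x, x \in I -> 0 < f x
    & forall (t : R) A B, 0 <= t <= 1 ->
      strictly_positive A -> strictly_positive B ->
      spectrum_in I A -> spectrum_in I B ->
      op_le (cfc f (gmean t A B)) (gmean t (cfc f A) (cfc f B))].

End HilbertOperators.
Arguments op_geom_convex {R} H I f.

(* Main.v *)
Require Import Defs.
From mathcomp Require Import all_boot all_order all_algebra.
From mathcomp Require Import complex.
From mathcomp Require Import all_classical all_reals all_analysis.
From mathcomp Require Import ring lra.
Import Order.TTheory GRing.Theory Num.Theory.
Import numFieldNormedType.Exports.
(* Put A #_t B = S C^t S with S = A^(1/2) and C = A^(-1/2) B A^(-1/2). Powers of
   C multiply, so (A #_s B) # (A #_t B) = A #_((s + t)/2) B; in particular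
   A # B = (A #_t B) # (A #_(1-t) B), and geometric convexity of f bounds f(A # B)
   by the integrand at every t. In the other direction, apply convexity to each
   of f(A #_t B) and f(A #_(1-t) B), use that # is monotone in both arguments,
   and use the same midpoint identity for f(A) and f(B).

   Monotonicity of # comes from the Riccati equation X A^-1 X = B, whose only
   positive solution is X = A # B, together with the monotonicity of the square
   root and the antitonicity of the inverse. It also gives m <= A #_t B <= M
   whenever m <= A, B <= M: first for dyadic t by repeated midpoints, then for
   all t by continuity. Hence all the spectra involved lie in a compact interval
   [m, M] contained in I, on which the functional calculus is controlled by
   polynomial approximation.

   Order relations are handled through the real inner product Re <x, y>, which
   turns them into inequalities between real numbers. *)

Set Implicit Arguments.
Unset Strict Implicit.
Unset Printing Implicit Defensive.
Local Open Scope classical_set_scope.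
Local Open Scope ring_scope.
Local Open Scope complex_scope.

(** [cfc] and [rint] are chosen with default value 0, so both limits must be shown to exist before
    any inequality about them has content. For [rint] this takes norm continuity of the integrand in
    t. Since I may be open or unbounded, that continuity needs all the operators A #_t B to be
    confined to one compact part of I; this is the purpose of the bound m <= A #_t B <= M.

    On the spectral side two facts suffice: bounds on the quadratic form confine the spectrum, and
    the infimum of the form is a spectral point. Together with the factorization of complex
    polynomials they bound the norm of p(T) by the supremum of |p| on the spectrum, without a
    spectral radius formula or Gelfand theory.

    Monotonicity is used for the weight 1/2 only. The Loewner-Heinz inequality is therefore needed
    only for the square root; other exponents enter through the exponent law and continuity in the
    exponent. *)

Section ComplexParts.
Context {R : realType}.
Implicit Types u v : R[i].

Lemma ReD u v : complex.Re (u + v) = complex.Re u + complex.Re v.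
Proof. by case: u; case: v. Qed.

Lemma ReM u v :
  complex.Re (u * v) = complex.Re u * complex.Re v - complex.Im u * complex.Im v.
Proof. by case: u; case: v. Qed.

Lemma Re_conj u : complex.Re (Num.conj u) = complex.Re u.
Proof. by case: u. Qed.

Lemma real_complexN1 : (-1)%:C = -1 :> R[i].
Proof. by rewrite rmorphN1. Qed.

End ComplexParts.

(** * Quadratic forms of operators *)

Section RealInnerProduct.
Context {R : realType} {H : hilbertType R}.
Implicit Types (x y z : H) (S T : bop H) (a b c : R).

Definition rdot x y : R := complex.Re (hdot x y).

Lemma rdotC x y : rdot x y = rdot y x.
Proof. by rewrite /rdot hermC expr0 mul1r; exact: Re_conj. Qed.

Lemma rdotDl x y z : rdot (x + y) z = rdot x z + rdot y z.
Proof. by rewrite /rdot linearDl ReD. Qed.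

Lemma rdotZl a x y : rdot (a%:C *: x) y = a * rdot x y.
Proof. by rewrite /rdot linearZl_LR ReM /= mul0r subr0. Qed.

Lemma rdot_adjZ (c : R[i]) x y : rdot (c *: x) y = rdot x (c^* *: y).
Proof.
rewrite /rdot linearZl_LR linearZr_LR /=; congr (complex.Re (_ * _)).
by case: c => a b /=; rewrite /Num.conj /= opprK.
Qed.

Lemma rdot0l y : rdot 0 y = 0.
Proof. by rewrite -(scale0r (0 : H)) -(rmorph0 (real_complex R)) rdotZl mul0r. Qed.

Lemma rdotNl x y : rdot (- x) y = - rdot x y.
Proof. by rewrite -[- x]scaleN1r -real_complexN1 rdotZl mulN1r. Qed.

Lemma rdotDr x y z : rdot z (x + y) = rdot z x + rdot z y.
Proof. by rewrite rdotC rdotDl !(rdotC z). Qed.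

Lemma rdotZr a x y : rdot y (a%:C *: x) = a * rdot y x.
Proof. by rewrite rdotC rdotZl rdotC. Qed.

Lemma rdotNr x y : rdot y (- x) = - rdot y x.
Proof. by rewrite rdotC rdotNl rdotC. Qed.

Lemma rdot0r y : rdot y 0 = 0.
Proof. by rewrite rdotC rdot0l. Qed.

Definition rdotE := (rdot0l, rdot0r, rdotDl, rdotDr, rdotNl, rdotNr, rdotZl,
  rdotZr).

Lemma rdot_norm x : (rdot x x)%:C = `|x| ^+ 2.
Proof.
rewrite -hdot_norm /rdot; have : 0 <= hdot x x by rewrite hdot_norm exprn_ge0.
by rewrite lecE /= => /andP[/eqP h _]; case: (hdot x x) h => a b /= ->.
Qed.

Lemma rdot_ge0 x : 0 <= rdot x x.
Proof. by rewrite -lecR rdot_norm exprn_ge0. Qed.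

Lemma rdot_eq0 x : rdot x x = 0 -> x = 0.
Proof.
by move=> h; apply/normr0_eq0/eqP; rewrite -sqrf_eq0 -rdot_norm h.
Qed.

Lemma rdot_gt0 x : x != 0 -> 0 < rdot x x.
Proof.
move=> x0; rewrite lt_def rdot_ge0 andbT; apply: contra x0 => /eqP h.
by rewrite (rdot_eq0 h).
Qed.

Lemma rdot_inj x y : (forall z, rdot x z = rdot y z) -> x = y.
Proof.
move=> h; apply/eqP; rewrite -subr_eq0; apply/eqP/rdot_eq0.
by rewrite rdotDl h rdotNl subrr.
Qed.

Lemma rdot_le0 x : rdot x x <= 0 -> x = 0.
Proof. by move=> h; apply: rdot_eq0; apply/le_anti; rewrite h rdot_ge0. Qed.

Lemma bopDE S T x : (S + T) x = S x + T x. Proof. by []. Qed.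
Lemma bopNE S x : (- S) x = - S x. Proof. by []. Qed.
Lemma bopZE (c : R[i]) S x : (c *: S) x = c *: S x. Proof. by []. Qed.
Lemma bopME S T x : (S * T) x = S (T x). Proof. by []. Qed.
Lemma bop1E x : (1 : bop H) x = x. Proof. by []. Qed.
Lemma bop0E x : (0 : bop H) x = 0. Proof. by []. Qed.
Lemma bopD T x y : T (x + y) = T x + T y.
Proof. by have := bop_linear T 1 x y; rewrite !scale1r. Qed.
Lemma bopN T x : T (- x) = - T x.
Proof. by rewrite -scaleN1r bopZ scaleN1r. Qed.

Definition bopE := (bopDE, bopNE, bopZE, bopME, bop1E, bop0E).
Definition bop_linE := (bopD, bopN, @bopZ R H).

Lemma bop_scaleAl (c : R[i]) S T : c *: S * T = c *: (S * T).
Proof. by apply: bop_ext => x. Qed.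

Lemma bop_scaleAr (c : R[i]) S T : S * (c *: T) = c *: (S * T).
Proof. by apply: bop_ext => x; rewrite !bopE bopZ. Qed.

(** For a complex-linear [T] this is full self-adjointness: replacing [y] by ['i *: y] recovers the
    imaginary part. *)
Definition op_sym T := forall x y, rdot (T x) y = rdot x (T y).

(** Stands in for an inclusion of the spectrum in [[m, M]]; unlike that inclusion it passes directly
    through conjugation and norm limits. *)
Definition op_between m M T :=
  op_sym T /\ forall x, m * rdot x x <= rdot (T x) x <= M * rdot x x.

(** The operator order without the self-adjointness of the difference; [op_leP] puts the two
    together. *)
Definition form_le S T := forall x, rdot (S x) x <= rdot (T x) x.

Lemma symD S T : op_sym S -> op_sym T -> op_sym (S + T).
Proof. by move=> hS hT x y; rewrite !bopE !rdotE hS hT. Qed.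
Lemma symN S : op_sym S -> op_sym (- S).
Proof. by move=> hS x y; rewrite !bopE !rdotE hS. Qed.
Lemma symB S T : op_sym S -> op_sym T -> op_sym (S - T).
Proof. by move=> hS hT; apply: symD => //; apply: symN. Qed.
Lemma symZ a S : op_sym S -> op_sym (a%:C *: S).
Proof. by move=> hS x y; rewrite !bopE !rdotE hS. Qed.
Lemma sym1 : op_sym 1. Proof. by []. Qed.
Lemma sym0 : op_sym 0. Proof. by move=> x y; rewrite !bop0E !rdotE. Qed.
Lemma sym_conj S T : op_sym S -> op_sym T -> op_sym (S * T * S).
Proof. by move=> hS hT x y; rewrite !bopE hS hT hS. Qed.
Lemma sym_comm S T : op_sym S -> op_sym T -> S * T = T * S -> op_sym (S * T).
Proof. by move=> hS hT e x y; rewrite {1}e !bopE hT hS. Qed.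

(** Polarization: the form at [x + y] determines the mixed terms, which coincide by symmetry. *)
Lemma sym_inj S T : op_sym S -> op_sym T ->
  (forall x, rdot (S x) x = rdot (T x) x) -> S = T.
Proof.
move=> hS hT h; apply: bop_ext => x; apply: rdot_inj => y.
have := h (x + y); rewrite !bop_linE !rdotE !h (hS y x) (hT y x) !(rdotC y); lra.
Qed.

Lemma form_le_anti S T : op_sym S -> op_sym T -> form_le S T -> form_le T S ->
  S = T.
Proof.
by move=> hS hT h1 h2; apply: sym_inj => // x; apply/le_anti; rewrite h1 h2.
Qed.

Lemma form_le_trans T S U : form_le S T -> form_le T U -> form_le S U.
Proof. by move=> h1 h2 x; apply: le_trans (h1 x) (h2 x). Qed.

Lemma form_le_conj C S T : op_sym C -> form_le S T ->
  form_le (C * S * C) (C * T * C).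
Proof. by move=> hC h x; rewrite !bopE !hC. Qed.

Lemma Im_hdot x y : complex.Im (hdot x y) = rdot x ('i *: y).
Proof.
rewrite /rdot linearZr_LR /= ReM.
by rewrite -[complex.Re (Num.conj _)]/0 -[complex.Im (Num.conj _)]/(-1 : R); ring.
Qed.

Lemma rdot_iZ x y : rdot ('i *: x) y = - rdot x ('i *: y).
Proof.
rewrite rdot_adjZ -rdotNr -scaleNr; congr (rdot _ (_ *: _)).
by apply/eqP; rewrite eq_complex /= oppr0 !eqxx.
Qed.

(** With [U = T - S], a nonnegative element of [R[i]] has zero imaginary part, so
    [rdot (U x) ('i *: x) = 0] for all [x]. Polarizing this and replacing one vector by its multiple
    by ['i] gives the symmetry of [U]. *)
Lemma op_leP S T : op_le S T <-> op_sym (T - S) /\ form_le S T.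
Proof.
have hleE x : (0 <= hdot ((T - S) x) x) =
    (rdot ((T - S) x) ('i *: x) == 0) && (0 <= rdot ((T - S) x) x).
  by rewrite lecE /= Im_hdot.
split=> [h|[hs h] x]; last first.
  rewrite hleE; apply/andP; split.
    have := rdot_iZ ((T - S) x) x; rewrite -bopZ hs (rdotC _ ((T - S) x)) => e.
    by apply/eqP; lra.
  by rewrite bopDE bopNE !rdotE subr_ge0.
have h1 x : 0 <= rdot ((T - S) x) x by have := h x; rewrite hleE => /andP[].
have hi x : rdot ((T - S) x) ('i *: x) = 0.
  by have := h x; rewrite hleE => /andP[/eqP].
split; last by move=> x; have := h1 x; rewrite !bopE !rdotE; lra.
move: (T - S) h1 hi => U h1 hi x y.
have hU z : rdot (U z) ('i *: y) + rdot (U y) ('i *: z) = 0.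
  by have := hi (z + y); rewrite bopD scalerDr !rdotE !hi; lra.
have iiE (z : H) : 'i *: ('i *: z) = - z.
  rewrite scalerA -scaleN1r; congr (_ *: _).
  by apply/eqP; rewrite eq_complex /=; apply/andP; split; apply/eqP; ring.
by have := hU ('i *: x); rewrite bopZ rdot_iZ !iiE !rdotE (rdotC x); lra.
Qed.

Lemma rdot_bop_le T x : rdot (T x) (T x) <= opnorm T ^+ 2 * rdot x x.
Proof.
have e : (opnorm T ^+ 2 * rdot x x)%:C = ((opnorm T)%:C * `|x|) ^+ 2.
  by rewrite exprMn -rdot_norm -rmorphXn -rmorphM.
rewrite -lecR e rdot_norm lerXn2r ?nnegrE ?mulr_ge0 ?lecR ?opnorm_ge0//.
exact: opnorm_bound.
Qed.

Lemma opnorm_le_rdot T c : 0 <= c ->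
  (forall x, rdot (T x) (T x) <= c ^+ 2 * rdot x x) -> opnorm T <= c.
Proof.
move=> c0 h; apply: opnorm_le => x x1.
rewrite -(@ler_pXn2r _ 2)// ?nnegrE ?lecR// -rdot_norm -rmorphXn lecR.
apply: le_trans (h x) _; rewrite ler_piMr ?exprn_ge0// -lecR rdot_norm.
by rewrite expr_le1.
Qed.

Lemma opnorm0 : opnorm (0 : bop H) = 0.
Proof.
apply/le_anti; rewrite opnorm_ge0 andbT opnorm_le_rdot// => x.
by rewrite bop0E !rdotE expr0n mul0r.
Qed.

Lemma opnorm1 : opnorm (1 : bop H) <= 1.
Proof. by apply: opnorm_le_rdot => // x; rewrite expr1n mul1r. Qed.

Lemma opnorm_tri S T : opnorm (S + T) <= opnorm S + opnorm T.
Proof. by rewrite -lecR rmorphD opnormD. Qed.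

Lemma opnormZr a T : opnorm (a%:C *: T) = `|a| * opnorm T.
Proof. apply: (@complexI R); rewrite opnormZ normc_def /= expr0n addr0 sqrtr_sqr.
by rewrite rmorphM. Qed.

Lemma opnormN T : opnorm (- T) = opnorm T.
Proof.
rewrite -scaleN1r -real_complexN1 opnormZr.
by rewrite normrN1 mul1r.
Qed.

Lemma opnormM S T : opnorm (S * T) <= opnorm S * opnorm T.
Proof.
apply: opnorm_le_rdot => [|x]; first by rewrite mulr_ge0 ?opnorm_ge0.
rewrite bopME (le_trans (rdot_bop_le _ _))// exprMn -[leRHS]mulrA.
by rewrite ler_wpM2l ?exprn_ge0 ?opnorm_ge0 ?rdot_bop_le.
Qed.

(** Expanding [|K x + T x|^2 >= 0] and [|K x - T x|^2 >= 0] with [|T x| <= K |x|] does the work of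
    Cauchy-Schwarz. The bound is divided by [K], hence the separate case [K = 0]. *)
Lemma sym_between K T : op_sym T -> opnorm T <= K -> op_between (- K) K T.
Proof.
move=> hT hK; split=> // x.
have K0 : 0 <= K := le_trans (opnorm_ge0 T) hK.
have := rdot_bop_le T x; have := rdot_ge0 x.
have hK2 : opnorm T ^+ 2 * rdot x x <= K ^+ 2 * rdot x x.
  by rewrite ler_wpM2r ?rdot_ge0// lerXn2r ?nnegrE ?opnorm_ge0.
have := rdot_ge0 (K%:C *: x + T x); have := rdot_ge0 (K%:C *: x - T x).
rewrite !rdotE (rdotC x (T x)).
move: K0; rewrite le_eqVlt => /predU1P[K0|K0].
  rewrite -K0 expr0n mul0r in hK2; move=> _ _ h0 h1.
  have /rdot_le0 -> : rdot (T x) (T x) <= 0 by lra.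
  by rewrite -K0 !rdotE; lra.
move: (rdot x x) (rdot (T x) x) (rdot (T x) (T x)) hK2 => p q r hK2 h1 h2 h3 h4.
by apply/andP; split; rewrite -(ler_pM2l K0); lra.
Qed.

Lemma between_sqr M T x : op_between (- M) M T ->
  rdot (T x) (T x) <= M ^+ 2 * rdot x x.
Proof.
move=> [hT h].
have h1 y := proj1 (andP (h y)); have h2 y := proj2 (andP (h y)).
have xx := rdot_ge0 x.
(* For [M < 0] the two bounds force [x = 0]; for [M = 0] the form vanishes and [T = 0] by
   polarization. *)
have [M0|M0] := lerP M 0.
  have : rdot x x = 0 \/ M = 0.
    have := h1 x; have := h2 x; case: (ltrgtP M 0) M0 => // [Mn|->] _;
      last by right.
    by move=> a1 a2; left; nra.
  case=> [/rdot_eq0 ->|M00].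
    by rewrite bop0 !rdotE; lra.
  have q0 y : rdot (T y) y = 0 by have := h1 y; have := h2 y; rewrite M00; lra.
  have -> : T = 0.
    by apply: sym_inj => //; [exact: sym0|move=> y; rewrite q0 bop0E !rdotE; lra].
  by rewrite bop0E !rdotE M00; lra.
(* [2M(M^2 - T^2) = (M+T)(M-T)(M+T) + (M-T)(M+T)(M-T)] *)
have := h1 (M%:C *: x - T x); have := h2 (M%:C *: x + T x).
rewrite !bop_linE !rdotE (hT (T x) x) (rdotC x (T x)).
move=> a1 a2; rewrite -(ler_pM2l M0); nra.
Qed.

Lemma between_opnorm M T : 0 <= M -> op_between (- M) M T -> opnorm T <= M.
Proof. by move=> M0 h; apply: opnorm_le_rdot => // x; apply: between_sqr. Qed.

End RealInnerProduct.
(** * Completeness and the Neumann series *)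

Section Complete.
Context {R : realType} {H : hilbertType R}.
Implicit Types (x y z : H) (S T L : bop H) (a b c : R) (u : nat -> bop H).

Definition op_cvg u L := forall e : R, 0 < e ->
  exists N, forall n, (N <= n)%N -> opnorm (u n - L) <= e.

Lemma norm_bop_le T x (e : R) : opnorm T <= e -> `|T x| <= e%:C * `|x|.
Proof.
by move=> h; rewrite (le_trans (opnorm_bound T x))// ler_wpM2r// lecR.
Qed.

(** The pointwise limit exists by completeness of [H]. The Cauchy estimate passes to it with a
    factor [|x|], which yields both its boundedness and convergence in norm. *)
Lemma bop_complete u :
  (forall e : R, 0 < e -> exists N, forall m n, (N <= m)%N -> (N <= n)%N ->
     opnorm (u m - u n) <= e) ->
  exists L, op_cvg u L.
Proof.
move=> uC.
have cx x : cvgn (fun n => u n x).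
  apply: cauchy_cvg; apply: cauchy_exP => e e0.
  have k0 : 0 < complex.Re e / (complex.Re `|x| + 1).
    rewrite divr_gt0//; first by move: e0; rewrite ltcE /= => /andP[].
    by rewrite ltr_wpDl// -lecR RRe_real ?normr_real ?normr_ge0.
  have [N hN] := uC _ k0; exists (u N x); exists N => // n /= Nn.
  rewrite -ball_normE /=.
  have := norm_bop_le x (hN _ _ (leqnn N) Nn).
  rewrite !bopE => /le_lt_trans; apply.
  have nx : `|x| = (complex.Re `|x|)%:C by rewrite RRe_real ?normr_real.
  have ee : e = (complex.Re e)%:C by rewrite RRe_real ?gtr0_real.
  rewrite [ltRHS]ee [X in _ * X]nx -rmorphM ltcR.
  move: k0; rewrite ee ltcR /= in e0 *.
  have : 0 <= complex.Re `|x| by rewrite -lecR -nx normr_ge0.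
  move: (complex.Re `|x|) (complex.Re e) e0 => p q q0 p0 _.
  by rewrite mulrAC ltr_pdivrMr; nra.
pose l x := limn (fun n => u n x).
have lP x : (fun n => u n x) @ \oo --> l x := cx x.
have lu e N x : (forall m n, (N <= m)%N -> (N <= n)%N -> opnorm (u m - u n) <= e) ->
    forall n, (N <= n)%N -> `|u n x - l x| <= e%:C * `|x|.
  move=> hN n Nn; apply/ler_addgt0Pr => d d0.
  have /cvgrPdist_lt /(_ _ d0) [M _ hM] := lP x.
  have := hM (maxn M N) (leq_maxl _ _); rewrite /= distrC => h1.
  have := norm_bop_le x (hN _ _ Nn (leq_maxr M N)); rewrite !bopE => h2.
  rewrite -(subrKA (u (maxn M N) x)) (le_trans (ler_normD _ _))// lerD// ltW//.
have lin : linear l.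
  move=> a x y; apply: cvg_lim => //.
  rewrite (_ : (fun n => _) = (fun n => a *: u n x + u n y)); last first.
    by apply/funext => n; rewrite bop_linear.
  by apply: cvgD; [apply: cvgZr; exact: lP|exact: lP].
have lb : l \in bounded_op.
  apply/asboolP; split=> //.
  have [N hN] := uC 1 ltr01; exists (opnorm (u N) + 1) => x.
  rewrite rmorphD mulrDl addrC.
  rewrite (_ : l x = - (u N x - l x) + u N x); last by rewrite opprB subrK.
  rewrite (le_trans (ler_normD _ _))// normrN lerD// ?(lu _ N)//.
  by apply: opnorm_bound.
exists (Bop lb) => e e0; have [N hN] := uC e e0; exists N => n Nn.
apply: opnorm_le => x x1; rewrite (le_trans (lu _ _ x hN _ Nn))//.
by rewrite ler_piMr// lecR ltW.
Qed.

Lemma op_cvg_unique u L L' : op_cvg u L -> op_cvg u L' -> L = L'.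
Proof.
move=> h h'; apply/eqP; rewrite -subr_eq0; apply/eqP.
apply: opnorm_eq0; congr (_%:C); apply/le_anti; rewrite opnorm_ge0 andbT.
apply/ler_addgt0Pr => e e0; rewrite add0r.
have e2 : 0 < e / 2 by rewrite divr_gt0.
have [N hN] := h _ e2; have [N' hN'] := h' _ e2.
rewrite (_ : L - L' = - (u (maxn N N') - L) + (u (maxn N N') - L')); last first.
  by rewrite opprB addrA subrK.
rewrite (le_trans (opnorm_tri _ _))// opnormN [e]splitr.
by rewrite lerD ?hN ?hN'// ?leq_maxl ?leq_maxr.
Qed.

Lemma op_cvg_mulr S u L : op_cvg u L -> op_cvg (fun n => S * u n) (S * L).
Proof.
move=> h e e0; have K0 : 0 < opnorm S + 1 by rewrite ltr_wpDl// opnorm_ge0.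
have [N hN] := h _ (divr_gt0 e0 K0); exists N => n /hN.
rewrite ler_pdivlMr// => hn; rewrite -mulrBr (le_trans (opnormM _ _))//.
apply: le_trans hn; rewrite mulrC ler_wpM2l ?opnorm_ge0//.
by rewrite lerDl.
Qed.

Lemma op_cvg_mull S u L : op_cvg u L -> op_cvg (fun n => u n * S) (L * S).
Proof.
move=> h e e0; have K0 : 0 < opnorm S + 1 by rewrite ltr_wpDl// opnorm_ge0.
have [N hN] := h _ (divr_gt0 e0 K0); exists N => n /hN.
rewrite ler_pdivlMr// => hn; rewrite -mulrBl (le_trans (opnormM _ _))//.
apply: le_trans hn; rewrite ler_wpM2l ?opnorm_ge0//.
by rewrite lerDl.
Qed.

Lemma opnormX T n : opnorm (T ^+ n) <= opnorm T ^+ n.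
Proof.
elim: n => [|n IH]; first exact: opnorm1.
by rewrite !exprS (le_trans (opnormM _ _))// ler_wpM2l// opnorm_ge0.
Qed.

Lemma geometric_to0 (q : R) : 0 <= q < 1 -> forall e : R, 0 < e ->
  exists N, forall n, (N <= n)%N -> q ^+ n <= e.
Proof.
move=> /andP[q0 q1] e e0.
have : (fun n => q ^+ n) @ \oo --> (0 : R) by apply: cvg_expr; rewrite ger0_norm.
move=> /cvgrPdist_le /(_ _ e0) [N _ hN]; exists N => n /hN /=.
by rewrite sub0r normrN ger0_norm// exprn_ge0.
Qed.

(** [op_spectrum T z] unfolds to the negation of this predicate at [T - z *: 1], so each is used
    directly for the other. *)
Definition invertible T := exists V, T * V = 1 /\ V * T = 1.

Lemma invertible_near1 T : opnorm (1 - T) < 1 -> invertible T.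
Proof.
set K := 1 - T => K1.
have TE : T = 1 - K by rewrite /K opprB addrC subrK.
have q01 : 0 <= opnorm K < 1 by rewrite opnorm_ge0.
pose u n := \sum_(k < n) K ^+ k.
have uS n : u n.+1 = 1 + K * u n.
  rewrite /u big_ord_recl expr0 mulr_sumr; congr (_ + _).
  by apply: eq_bigr => i _; rewrite -exprS.
have uT n : (1 - K) * u n = 1 - K ^+ n.
  elim: n => [|n IH]; first by rewrite /u big_ord0 mulr0 expr0 subrr.
  by rewrite /u big_ord_recr /= mulrDr IH mulrBl mul1r -exprS addrA subrK.
have Tu n : u n * (1 - K) = 1 - K ^+ n.
  elim: n => [|n IH]; first by rewrite /u big_ord0 mul0r expr0 subrr.
  by rewrite /u big_ord_recr /= mulrDl IH mulrBr mulr1 -exprSr addrA subrK.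
have d1 : 0 < 1 - opnorm K by rewrite subr_gt0.
(* The difference [D = u n - u m] satisfies [D = K^m - K^n + K D]; absorbing the last term on the
   left replaces summing the geometric tail. *)
have ub m n : opnorm (u n - u m) <= (opnorm K ^+ n +
  opnorm K ^+ m) / (1 - opnorm K).
  rewrite ler_pdivlMr// mulrBr mulr1 lerBlDr.
  have e : (1 - K) * (u n - u m) = K ^+ m - K ^+ n.
    by rewrite mulrBr !uT opprB addrC addrA subrK.
  rewrite {1}(_ : u n - u m = (- K ^+ n + K ^+ m) + K * (u n - u m)); last first.
    by rewrite addrC [- _ + _]addrC -e mulrBl mul1r addrC subrK.
  rewrite (le_trans (opnorm_tri _ _))// lerD//;
    last by rewrite [leRHS]mulrC opnormM.
  by rewrite (le_trans (opnorm_tri _ _))// opnormN lerD// opnormX.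
have [L hL] : exists L, op_cvg u L.
  apply: bop_complete => e e0.
  have e1 : 0 < e * (1 - opnorm K) / 2 by rewrite !(mulr_gt0, divr_gt0).
  have [N hN] := geometric_to0 q01 e1; exists N => m n Nm Nn.
  rewrite (le_trans (ub _ _))// ler_pdivrMr// [leRHS]splitr.
  by rewrite lerD// hN.
have K0 : op_cvg (fun n => 1 - K ^+ n) 1.
  move=> e e0; have [N hN] := geometric_to0 q01 e0; exists N => n Nn.
  by rewrite addrAC subrr add0r opnormN (le_trans (opnormX _ _))// hN.
exists L; split; apply: op_cvg_unique K0; rewrite TE.
  rewrite (_ : (fun n => _) = (fun n => (1 - K) * u n)); last first.
    by apply/funext => n; rewrite uT.
  exact: op_cvg_mulr.
rewrite (_ : (fun n => _) = (fun n => u n * (1 - K))); last first.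
  by apply/funext => n; rewrite Tu.
exact: op_cvg_mull.
Qed.

Lemma between_le m m' M M' T : m' <= m -> M <= M' -> op_between m M T ->
  op_between m' M' T.
Proof.
move=> hm hM [hT h]; split=> // x; have /andP[h1 h2] := h x.
rewrite (le_trans _ h1) ?ler_wpM2r ?rdot_ge0//.
by rewrite (le_trans h2)// ler_wpM2r ?rdot_ge0.
Qed.

(** Division by [K >= M] puts [1 - T / K] between 0 and [1 - c / K < 1], within reach of the Neumann
    series. Taking the maximum with [c] covers [M < c], which can occur on the zero space. *)
Lemma between_invertible c M T : 0 < c -> op_between c M T -> invertible T.
Proof.
move=> c0 hT.
pose K := Num.max M c; have K0 : 0 < K by rewrite lt_max c0 orbT.
have cK : c / K <= 1 by rewrite ler_pdivrMr// mul1r le_max lexx orbT.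
have [sT hT'] : op_between c K T by apply: between_le hT => //; rewrite le_max lexx.
have hb : op_between (- (1 - c / K)) (1 - c / K) (1 - K^-1%:C *: T).
  split; first by apply: symB; [exact: sym1|exact: symZ].
  move=> x; have /andP[h1 h2] := hT' x; have := rdot_ge0 x.
  rewrite !bopE !rdotE; move: (rdot x x) (rdot (T x) x) h1 h2 => p q h1 h2 p0.
  have h3 : K^-1 * (c * p) <= K^-1 * q by rewrite ler_wpM2l// invr_ge0 ltW.
  have : K^-1 * q <= p by rewrite mulrC ler_pdivrMr// mulrC.
  have : 0 <= (1 - c / K) * p by rewrite mulr_ge0// subr_ge0.
  by move: h3; rewrite mulrA [_ * c]mulrC; move: (c / K) (K^-1 * q) => ? ?; lra.
have [V [h1 h2]] : invertible (K^-1%:C *: T).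
  apply: invertible_near1.
  apply: le_lt_trans (between_opnorm _ hb) _; first by rewrite subr_ge0.
  by rewrite ltrBlDr ltrDl divr_gt0.
exists (K^-1%:C *: V); split.
  by rewrite bop_scaleAr -bop_scaleAl.
by rewrite bop_scaleAl -bop_scaleAr.
Qed.

End Complete.

(** * Polynomials in an operator and the spectrum *)

Section Horner.
Context {R : realType} {H : hilbertType R}.
Local Notation Id := (1 : bop H).
Implicit Types (x y z : H) (S T L : bop H) (a b c : R) (p q : {poly R[i]}).

Lemma op_hornerE p T n : (size p <= n)%N ->
  op_horner p T = \sum_(k < n) p`_k *: T ^+ k.
Proof.
move=> pn; rewrite /op_horner (big_ord_widen _ (fun k => p`_k *: T ^+ k) pn).
rewrite big_mkcond; apply: eq_bigr => k _ /=; case: ltnP => // h.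
by rewrite nth_default// scale0r.
Qed.

Lemma op_hornerD p q T : op_horner (p + q) T = op_horner p T + op_horner q T.
Proof.
pose n := maxn (size p) (size q).
rewrite (@op_hornerE p T n) ?leq_maxl// (@op_hornerE q T n) ?leq_maxr//.
rewrite (@op_hornerE _ T n) ?size_polyD// -big_split.
by apply: eq_bigr => k _; rewrite coefD scalerDl.
Qed.

Lemma op_hornerZ (c : R[i]) p T : op_horner (c *: p) T = c *: op_horner p T.
Proof.
rewrite (@op_hornerE _ T (size p)) ?size_scale_leq// /op_horner scaler_sumr.
by apply: eq_bigr => k _; rewrite coefZ scalerA.
Qed.

Lemma op_hornerC (c : R[i]) T : op_horner c%:P T = c *: Id.
Proof.
by rewrite (@op_hornerE _ T 1) ?size_polyC_leq1// big_ord1 coefC eqxx expr0.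
Qed.

Lemma op_horner0 T : op_horner 0 T = 0.
Proof. by rewrite /op_horner size_poly0 big_ord0. Qed.

Lemma op_hornerMX p T : op_horner (p * 'X) T = op_horner p T * T.
Proof.
rewrite (@op_hornerE _ T (size p).+1) ?size_polyMleq ?(leq_trans (size_polyMleq _
  _)) ?size_polyX ?addn2//.
rewrite big_ord_recl coefMX eqxx scale0r add0r mulr_suml.
by apply: eq_bigr => k _; rewrite coefMX /= exprSr bop_scaleAl.
Qed.

Lemma op_hornerM p q T : op_horner (p * q) T = op_horner p T * op_horner q T.
Proof.
elim/poly_ind: q => [|q c IH]; first by rewrite mulr0 op_horner0 mulr0.
rewrite mulrDr op_hornerD mulrA op_hornerMX IH mulrC mul_polyC op_hornerZ.
by rewrite op_hornerD op_hornerMX op_hornerC mulrDr mulrA bop_scaleAr mulr1.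
Qed.

Lemma op_hornerN p T : op_horner (- p) T = - op_horner p T.
Proof. by rewrite -scaleN1r op_hornerZ scaleN1r. Qed.

Lemma op_hornerB p q T : op_horner (p - q) T = op_horner p T - op_horner q T.
Proof. by rewrite op_hornerD op_hornerN. Qed.

Lemma op_hornerX T : op_horner 'X T = T.
Proof. by rewrite -['X]mul1r op_hornerMX op_hornerC scale1r mul1r. Qed.

Lemma op_hornerXB (c : R[i]) T : op_horner ('X - c%:P) T = T - c *: Id.
Proof. by rewrite op_hornerB op_hornerX op_hornerC. Qed.

(** As [T] is symmetric, only the coefficients are conjugated; this takes the place of an adjoint
    operation. *)
Lemma op_horner_adj p T : op_sym T -> forall x y,
  rdot (op_horner p T x) y = rdot x (op_horner (map_poly conjc p) T y).
Proof.
move=> hT; elim/poly_ind: p => [|p c IH] x y.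
  by rewrite rmorph0 op_horner0 !bopE !rdotE.
rewrite rmorphD rmorphM /= map_polyX map_polyC /= !op_hornerD !op_hornerMX.
rewrite !op_hornerC !bopE !rdotE IH hT rdot_adjZ; congr (rdot _ _ + _).
by rewrite -!bopME -{1}(op_hornerX T) -op_hornerM mulrC op_hornerMX.
Qed.

Lemma invertibleM S T : invertible S -> invertible T -> invertible (S * T).
Proof.
move=> [S' [h1 h2]] [T' [h3 h4]]; exists (T' * S'); split.
  by rewrite -mulrA (mulrA T) h3 mul1r.
by rewrite -mulrA (mulrA S') h2 mul1r.
Qed.

Lemma invertible1 : invertible (1 : bop H).
Proof. by exists 1; rewrite mulr1. Qed.

Lemma invertibleZ (c : R[i]) T : c != 0 -> invertible T -> invertible (c *: T).
Proof.
move=> c0 [T' [h1 h2]]; exists (c^-1 *: T').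
by rewrite !bop_scaleAl !bop_scaleAr h1 h2 !scalerA divff// mulVf// scale1r.
Qed.

Lemma invertibleN T : invertible T -> invertible (- T).
Proof. by rewrite -scaleN1r; apply: invertibleZ; rewrite oppr_eq0 oner_eq0. Qed.

(** If [V] inverts [S T], then [T V] is a right inverse of [S] and, by commutation, [V T] is a left
    inverse, so the two agree. *)
Lemma invertible_comm_factor S T : S * T = T * S -> invertible (S * T) ->
  invertible S.
Proof.
move=> e [V [h1 h2]].
have h3 : (V * T) * S = 1 by rewrite -mulrA -e.
exists (T * V); split; first by rewrite mulrA.
rewrite -[RHS]h3; congr (_ * _).
by rewrite -[RHS]mulr1 -h1 -[S * T * V]mulrA [RHS]mulrA h3 mul1r.
Qed.

(* For a nonreal z = a + ib, (T - z)(T - z^* ) = (T - a)^2 + b^2 is invertible. *)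
Lemma between_spectrum m M T (z : R[i]) : op_between m M T -> op_spectrum T z ->
  exists2 x : R, z = x%:C & m <= x <= M.
Proof.
move=> hT; apply: contra_notP => hz.
have [sT qT] := hT.
have [b0|b0] := eqVneq (complex.Im z) 0; last first.
  apply: (@invertible_comm_factor _ (T - z^* *: Id)).
    by rewrite -!op_hornerXB -!op_hornerM mulrC.
  set b := complex.Im z in b0; set a := complex.Re z.
  have hS : op_sym (T - a%:C *: Id) by apply: symB => //; apply: symZ; exact: sym1.
  have zE : z = a +i* b by rewrite /a /b; case: (z).
  have -> : (T - z *: Id) * (T - z^* *: Id) =
       (T - a%:C *: Id) * (T - a%:C *: Id) + (b ^+ 2)%:C *: Id.
    have zz : z * z^* = (a ^+ 2 + b ^+ 2)%:C.
      by rewrite zE; apply/eqP; rewrite eq_complex /=; apply/andP; split;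
        apply/eqP; ring.
    have zp : z + z^* = (a + a)%:C.
      by rewrite zE; apply/eqP; rewrite eq_complex /=; apply/andP; split;
        apply/eqP; ring.
    rewrite -!op_hornerXB -!op_hornerM -(op_hornerC _ T) -op_hornerD;
      congr op_horner.
    have -> : ('X - z%:P) * ('X - z^*%:P) = 'X * 'X - 'X * (z + z^*)%:P +
      (z * z^*)%:P.
      by rewrite polyCD polyCM; ring.
    by rewrite zz zp !rmorphD !rmorphXn /=; ring.
  have b2 : 0 < b ^+ 2 by rewrite exprn_even_gt0.
  apply: (between_invertible b2 (M := opnorm (T - a%:C *: Id) ^+ 2 + b ^+ 2));
    split.
    by apply: symD; [apply: sym_comm|apply: symZ; exact: sym1].
  move=> x; rewrite bopDE bopME bopZE bop1E rdotDl rdotZl hS mulrDl lerD2r.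
  by rewrite lerDr rdot_ge0 rdot_bop_le.
set a := complex.Re z; have zE : z = a%:C by move: b0; rewrite /a;
  case: (z) => ? ? /= ->.
have : ~~ (m <= a <= M) by apply/negP => h; apply: hz; exists a.
(* For real [z] outside [[m, M]], either [T - z] or [z - T] has a positive lower bound. *)
rewrite negb_and -!ltNge => /orP[am|am].
  apply: (@between_invertible _ _ (m - a) (M - a)); first by rewrite subr_gt0.
  split; first by apply: symB => //; rewrite zE; apply: symZ; exact: sym1.
  move=> x; have := qT x; rewrite !bopE zE !rdotE !mulrBl => /andP[h1 h2].
  by rewrite !lerB.
rewrite -[T - _]opprK; apply: invertibleN.
apply: (@between_invertible _ _ (a - M) (a - m)); first by rewrite subr_gt0.
split; first by apply: symN; apply: symB => //; rewrite zE; apply: symZ;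
  exact: sym1.
move=> x; have := qT x; rewrite !bopE zE !rdotE !mulrBl => /andP[h1 h2].
by rewrite opprB !lerB.
Qed.

Lemma sqr_le_pos M T : 0 < M -> op_between 0 M T ->
  forall x, rdot (T x) (T x) <= M * rdot (T x) x.
Proof.
move=> M0 [hT h] x.
(* [M(MT - T^2) = T(M-T)T + (M-T)T(M-T)] *)
have /andP[_ h1] := h (T x); have /andP[h2 _] := h (M%:C *: x - T x).
move: h1 h2; rewrite !bop_linE !rdotE (hT (T x) x) (rdotC x (T x)).
move: (rdot (T (T x)) (T x)) (rdot (T x) (T x)) (rdot (T x) x) => p q r h1 h2.
by rewrite -(ler_pM2l M0); lra.
Qed.

Lemma rdot_AMGM (r : R) x y : 0 < r ->
  2 * rdot x y <= r * rdot x x + r^-1 * rdot y y.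
Proof.
move=> r0; have := rdot_ge0 (r%:C *: x - y); rewrite !rdotE (rdotC y x) => h.
rewrite -(ler_pM2l r0) mulrDr (mulrA r r^-1) divff ?gt_eqF// mul1r; lra.
Qed.

(** The infimum of the Rayleigh quotients; the nonzero vector makes their set nonempty. *)
Lemma sym_inf T : op_sym T -> (exists x : H, x != 0) ->
  exists m, [/\ forall x, m * rdot x x <= rdot (T x) x &
    forall m', (forall x, m' * rdot x x <= rdot (T x) x) -> m' <= m].
Proof.
move=> hT [x0 x00].
pose A := [set rdot (T x) x / rdot x x | x in [set x : H | x != 0]].
have [_ hb] := sym_between hT (lexx _).
have lA : has_inf A.
  split; first by exists (rdot (T x0) x0 / rdot x0 x0), x0.
  exists (- opnorm T) => _ [x /= xn0 <-].
  by rewrite ler_pdivlMr ?rdot_gt0//; have /andP[] := hb x.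
exists (inf A); split=> [x|m' hm'].
  have [->|xn0] := eqVneq x 0; first by rewrite bop0 !rdotE mulr0.
  by rewrite -ler_pdivlMr ?rdot_gt0//; apply: ge_inf; [exact: lA.2|exists x].
apply: lb_le_inf; first exact: lA.1.
by move=> _ [x /= xn0 <-]; rewrite ler_pdivlMr ?rdot_gt0.
Qed.

(** A positive [Z] satisfies [Z^2 <= (|Z| + 1) Z], so a lower bound on [|Z x|^2] passes to the form.
    The added 1 keeps the divisor positive. *)
Lemma below_pos Z c : op_between 0 (opnorm Z + 1) Z -> 0 < c ->
  (forall x, c * rdot x x <= rdot (Z x) (Z x)) ->
  exists2 d, 0 < d & forall x, d * rdot x x <= rdot (Z x) x.
Proof.
move=> hZ c0 h; have K0 : 0 < opnorm Z + 1 by rewrite ltr_wpDl ?opnorm_ge0.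
exists (c / (opnorm Z + 1)); first by rewrite divr_gt0.
move=> x; have := le_trans (h x) (sqr_le_pos K0 hZ x).
by rewrite mulrAC ler_pdivrMr// [leRHS]mulrC.
Qed.

(* If T - m were invertible it would be bounded below, and, being positive,
   bounded below by a positive constant. *)
Lemma inf_spectrum m T : op_sym T -> (forall x, m * rdot x x <= rdot (T x) x) ->
  (forall m', (forall x, m' * rdot x x <= rdot (T x) x) -> m' <= m) ->
  op_spectrum T m%:C.
Proof.
move=> hT hm mmax [V [_ VT]]; set Z := T - _ in VT.
have sZ : op_sym Z by apply: symB => //; apply: symZ; exact: sym1.
have ZE x : rdot (Z x) x = rdot (T x) x - m * rdot x x by rewrite !bopE !rdotE.
have bZ : op_between 0 (opnorm Z + 1) Z.
  split=> // x; rewrite mul0r ZE subr_ge0 hm -ZE.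
  by have [_ /(_ x)/andP[]] := sym_between sZ (ler_wpDr ler01 (lexx _)).
pose K := opnorm V ^+ 2 + 1.
have K0 : 0 < K by rewrite ltr_wpDl ?exprn_ge0 ?opnorm_ge0.
have [d d0 hd] : exists2 d, 0 < d & forall x, d * rdot x x <= rdot (Z x) x.
  apply: (@below_pos Z K^-1) => //; first by rewrite invr_gt0.
  move=> x; rewrite ler_pdivrMl//.
  have := rdot_bop_le V (Z x); rewrite -bopME VT bop1E => /le_trans; apply.
  by rewrite ler_wpM2r ?rdot_ge0// lerDl.
have : m + d <= m by apply: mmax => x; rewrite mulrDl -lerBrDl -ZE.
by rewrite gerDl leNgt d0.
Qed.

Lemma op_horner_sym p T : op_sym T -> map_poly conjc p = p ->
  op_sym (op_horner p T).
Proof. by move=> hT hp x y; rewrite (op_horner_adj p hT) hp. Qed.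

(* The infimum mu of the form of p(T) is in the spectrum of p(T); factoring
   p - mu shows that mu = p(z) for some z in the spectrum of T. *)
Lemma op_horner_pos p T m M : op_between m M T -> map_poly conjc p = p ->
  (forall a, op_spectrum T a%:C -> 0 <= p.[a%:C]) ->
  forall x, 0 <= rdot (op_horner p T x) x.
Proof.
move=> hT pr hp x; have [->|x0] := eqVneq x 0; first by rewrite !rdotE.
have sp := op_horner_sym hT.1 pr.
have [mu [h1 h2]] := sym_inf sp (ex_intro _ x x0).
have spec := inf_spectrum sp h1 h2.
suff mu0 : 0 <= mu by apply: le_trans (h1 x); rewrite mulr_ge0 ?rdot_ge0.
(* If [p] is the constant [mu] there is no root to work with; instead the spectrum of [T] contains
   the infimum [t] of its form, and [mu = p(t) >= 0]. *)
have [p0|p0] := eqVneq (p - mu%:C%:P) 0.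
  have [t [t1 t2]] := sym_inf hT.1 (ex_intro _ x x0).
  have := hp _ (inf_spectrum hT.1 t1 t2).
  by move/eqP: p0; rewrite subr_eq0 => /eqP ->; rewrite hornerC lecR.
have [rs rsE] := closed_field_poly_normal (p - mu%:C%:P).
apply: contrapT => mun; apply: spec.
rewrite -[mu%:C *: _](op_hornerC _ T) -op_hornerB rsE op_hornerZ.
apply: invertibleZ; first by rewrite lead_coef_eq0.
have : forall z : R[i], z \in rs -> ~ op_spectrum T z.
  move=> z zr zs; have [a za _] := between_spectrum hT zs.
  have : root (p - mu%:C%:P) z.
    by rewrite rsE rootZ ?lead_coef_eq0// root_prod_XsubC.
  rewrite /root hornerD hornerN hornerC subr_eq0 => /eqP pz.
  apply: mun; rewrite -lecR -pz za; apply: hp; by rewrite -za.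
elim: rs {rsE} => [|z rs IH] hz.
  by rewrite big_nil op_hornerC scale1r; exact: invertible1.
rewrite big_cons op_hornerM; apply: invertibleM; last first.
  by apply: IH => w wr; apply: hz; rewrite inE wr orbT.
by rewrite op_hornerXB; apply: contrapT; apply: hz; rewrite inE eqxx.
Qed.

Lemma map_poly_conjC (a : R) : map_poly conjc a%:C%:P = a%:C%:P.
Proof. by rewrite map_polyC /= oppr0. Qed.

(* Positivity of [c^2 - p^* p] on the spectrum bounds the norm, even when the
   coefficients of p are not real. *)
Lemma op_horner_opnorm p T m M c : op_between m M T -> 0 <= c ->
  (forall a, op_spectrum T a%:C -> `|p.[a%:C]| <= c%:C) ->
  opnorm (op_horner p T) <= c.
Proof.
move=> hT c0 hp; apply: opnorm_le_rdot => // x.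
pose q := (c ^+ 2)%:C%:P - map_poly conjc p * p.
have qr : map_poly conjc q = q.
  have e : map_poly conjc (map_poly conjc p) = p.
    by rewrite -map_poly_comp map_poly_id// => z _ /=; rewrite conjcK.
  by rewrite rmorphB /= map_poly_conjC [X in _ - X]rmorphM /= e [p * _]mulrC.
have := op_horner_pos hT qr _ x.
rewrite op_hornerB op_hornerC op_hornerM !bopE !rdotE.
rewrite (rdotC _ x) -(op_horner_adj p hT.1) subr_ge0; apply => a /hp.
have -> : q.[a%:C] = (c ^+ 2)%:C - `|p.[a%:C]| ^+ 2.
  rewrite hornerD hornerN hornerC hornerM (_ : _.[_] * _ = `|p.[a%:C]| ^+ 2)//.
  have -> : (map_poly conjc p).[a%:C] = (p.[a%:C])^*.
    by rewrite -{1}[a%:C](_ : (a%:C)^* = _) ?horner_map //= oppr0.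
  by rewrite mulrC -add_Re2_Im2; case: (p.[_]) => u v; apply/eqP;
    rewrite eq_complex /=; apply/andP; split; apply/eqP; ring.
move=> h; rewrite subr_ge0 rmorphXn lerXn2r// nnegrE// lecR//.
Qed.

End Horner.

(** * Polynomial approximation *)

Section Weierstrass.
Context {R : realType}.
Implicit Types (a b c d e x y : R) (f g : R -> R) (phi psi : nat -> R).

Definition ucont_on a b f := forall e, 0 < e -> exists2 d : R, 0 < d &
  forall x y, a <= x <= b -> a <= y <= b -> `|x - y| < d -> `|f x - f y| <= e.

(** Heine-Cantor: half of a continuity radius at [x] works at all points near [x], and the
    near-covering form of compactness makes the radius uniform. *)
Lemma continuous_ucont_on a b f : {within `[a, b], continuous f} -> ucont_on a b f.
Proof.
move=> /subspace_continuousP fc e e0.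
have /compact_near_coveringP/(_ R (0^'+)) nc : compact `[a,
  b] by exact: segment_compact.
pose P (d x' : R) := `[a, b]%classic x' -> forall y, `[a, b]%classic y ->
  `|x' - y| < d -> `|f x' - f y| <= e.
have : \forall d \near 0^'+, `[a, b] `<=` P d.
  apply: nc => x abx; have e2 : 0 < e / 2 by rewrite divr_gt0.
  have := fc x abx; move=> /cvgrPdist_le /(_ _ e2).
  rewrite near_withinE near_simpl => /nbhs_ballP[d /= d0 hd].
  have d2 : 0 < d / 2 by rewrite divr_gt0.
  exists (ball x (d / 2), [set r | r < d / 2]).
    split; first by apply/nbhs_ballP; exists (d / 2).
    by apply: nbhs_right_lt.
  move=> [x' r] /= [hx' hr] abx' y aby xy.
  rewrite -ball_normE /= in hx'.
  have h1 : `|f x - f x'| <= e / 2.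
    by apply: hd => //; rewrite -ball_normE /=; lra.
  have h2 : `|f x - f y| <= e / 2.
    apply: hd => //; rewrite -ball_normE /= -(subrKA x').
    by rewrite (le_lt_trans (ler_normD _ _))// [ltRHS]splitr ltrD// (lt_trans xy).
  rewrite -(subrKA (f x)) (le_trans (ler_normD _ _))// [leRHS]splitr lerD//.
  by rewrite distrC.
move=> h; near (0:R)^'+ => d; exists d.
  by near: d; exact: nbhs_right_gt.
have hd : `[a, b] `<=` P d by near: d.
by move=> x y xab yab; apply: (hd x) => //=; rewrite in_itv.
Unshelve. all: by end_near. Qed.

(* The Bernstein polynomial [\sum_k 'C(n, k) phi(k) X^k (1 - X)^(n - k)], defined
   by conditioning on the first of n coin tosses, so that no binomial
   coefficients occur. *)
Fixpoint bernstein n phi : {poly R} :=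
  if n is n'.+1 then 'X * bernstein n' (phi \o succn) + (1 - 'X) * bernstein n' phi
  else (phi 0%N)%:P.

Lemma bernstein_le n phi psi x : 0 <= x <= 1 ->
  (forall k, (k <= n)%N -> phi k <= psi k) ->
    (bernstein n phi).[x] <= (bernstein n psi).[x].
Proof.
move=> /andP[x0 x1]; elim: n phi psi => [|n IH] phi psi h /=.
  by rewrite !hornerC h.
rewrite !hornerE lerD// ler_wpM2l ?subr_ge0// IH// => k kn.
  exact: h.
by apply: h; rewrite leqW.
Qed.

(* For 0 <= x <= 1 this is the total mass and the second moment about c of the
   binomial distribution. *)
Lemma bernstein_quad n a b c x :
  (bernstein n (fun k => a + b * (k%:R - c) ^+ 2)).[x] =
  a + b * (n%:R * x * (1 - x) + (n%:R * x - c) ^+ 2).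
Proof.
elim: n c => [|n IH] c /=; first by rewrite hornerC; ring.
rewrite !hornerE IH; have -> : (fun k => a + b * (k%:R - c) ^+ 2) \o succn =
    (fun k => a + b * (k%:R - (c - 1)) ^+ 2).
  by apply/funext => k /=; rewrite -natr1; ring.
by rewrite IH -natr1; ring.
Qed.

(** Bernstein's argument: [|f x - f y|] is at most [e / 2] for [|x - y| < d], and at most
    [2 M (x - y)^2 / d^2] otherwise. Since [bernstein] is monotone and exact on quadratics, only the
    variance of the binomial distribution remains. *)
Lemma weierstrass01 f (M : R) : (forall x, 0 <= x <= 1 -> `|f x| <= M) ->
  ucont_on 0 1 f ->
  forall e, 0 < e -> exists p : {poly R}, forall x, 0 <= x <= 1 ->
    `|f x - p.[x]| <= e.
Proof.
move=> fM fu e e0; have e2 : 0 < e / 2 by rewrite divr_gt0.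
have [d d0 hd] := fu _ e2.
have M0 : 0 <= M by rewrite (le_trans _ (fM 0 _))// lexx ler01.
have K0 : 0 <= 4 * M / (d ^+ 2 * e) by apply: divr_ge0; apply: mulr_ge0 => //;
  rewrite ?exprn_ge0 ?ltW.
pose n := (Num.truncn (4 * M / (d ^+ 2 * e))).+1.
have nP : 4 * M <= n%:R * (d ^+ 2 * e).
  by rewrite -ler_pdivrMr ?mulr_gt0 ?exprn_gt0// ltW// truncnS_gt.
have n0 : 0 < n%:R :> R by rewrite ltr0n.
exists (bernstein n (fun k => f (k%:R / n%:R))) => x x01.
have x1 : 0 <= x * (1 - x) <= 1 by move/andP: x01 => [? ?]; apply/andP; split; nra.
(* The extra [n^2] appears because the quadratic is in [k - n x] rather than [k / n - x]. Then
   [be * (n x (1 - x)) <= 2 M / (d^2 n)], which the choice of [n] makes at most [e / 2]. *)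
pose be := 2 * M / (d ^+ 2 * n%:R ^+ 2).
have be0 : 0 <= be by apply: divr_ge0; apply: mulr_ge0 => //;
  rewrite exprn_ge0 ?ltW.
have key k : (k <= n)%N ->
    `|f x - f (k%:R / n%:R)| <= e / 2 + be * (k%:R - n%:R * x) ^+ 2.
  move=> kn; have k01 : 0 <= (k%:R / n%:R : R) <= 1.
    by rewrite divr_ge0 ?ler0n// ler_pdivrMr// mul1r ler_nat.
  have [h|h] := ltP `|x - k%:R / n%:R| d.
    by rewrite (le_trans (hd _ _ x01 k01 h))// lerDl mulr_ge0// sqr_ge0.
  have h1 : `|f x - f (k%:R / n%:R)| <= 2 * M.
    by have := ler_normB (f x) (f (k%:R / n%:R)); have := fM _ x01;
      have := fM _ k01; lra.
  rewrite (le_trans h1)// ler_wpDl// ?(ltW e2)//.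
  rewrite /be mulrAC ler_pdivlMr ?mulr_gt0 ?exprn_gt0//.
  rewrite ler_wpM2l// ?mulr_ge0//.
  have -> : (k%:R - n%:R * x) ^+ 2 = `|x - k%:R / n%:R| ^+ 2 * n%:R ^+ 2.
    by rewrite real_normK ?num_real//; field; rewrite pnatr_eq0.
  by rewrite ler_wpM2r ?sqr_ge0// lerXn2r ?nnegrE ?normr_ge0 ?(ltW d0).
have fin : be * (n%:R * x * (1 - x)) <= e / 2.
  rewrite /be mulrAC ler_pdivrMr ?mulr_gt0 ?exprn_gt0//.
  rewrite -mulrA [X in X <= _](_ : _ = (4 * M) * (n%:R * (x * (1 - x))) / 2);
    last by field.
  rewrite [leRHS](_ : _ = (n%:R * (d ^+ 2 * e)) * (n%:R * 1) / 2); last by field.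
  rewrite ler_wpM2r ?invr_ge0// ler_pM//.
  - by rewrite mulr_ge0.
  - by rewrite mulr_ge0 ?ler0n//; case/andP: x1.
  - by rewrite ler_wpM2l ?ler0n//; case/andP: x1.
rewrite ler_norml; apply/andP; split.
  rewrite lerBrDl -lerBrDr opprK.
  have := @bernstein_le n (fun k => f (k%:R / n%:R)) (fun k => (f x + e / 2) +
    be * (k%:R - n%:R * x) ^+ 2) x x01.
  rewrite bernstein_quad subrr expr0n addr0 => /(_ _)/le_trans; apply.
    by move=> k /key; rewrite ler_norml => /andP[]; lra.
  by rewrite [X in _ <= _ + X]splitr addrA lerD2l.
rewrite lerBlDr -lerBlDl.
have := @bernstein_le n (fun k => (f x - e / 2) +
  (- be) * (k%:R - n%:R * x) ^+ 2) (fun k => f (k%:R / n%:R)) x x01.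
rewrite bernstein_quad subrr expr0n addr0 => h; apply: le_trans (h _).
  by rewrite mulNr [X in _ - X <= _]splitr opprD addrA lerB.
by move=> k /key; rewrite ler_norml => /andP[]; lra.
Qed.

Lemma weierstrass a b f : {within `[a, b], continuous f} ->
  forall e, 0 < e -> exists p : {poly R}, forall x, a <= x <= b ->
    `|f x - p.[x]| <= e.
Proof.
move=> fc e e0; have [ab|] := ltP a b; last first.
  move=> ba; exists (f a)%:P => x /andP[ax xb].
  rewrite (_ : x = a); last by apply/le_anti; rewrite ax (le_trans xb).
  by rewrite hornerC subrr normr0 ltW.
have ab0 : 0 < b - a by rewrite subr_gt0.
have rg x : 0 <= x <= 1 -> a <= a + (b - a) * x <= b.
  by move=> /andP[? ?]; apply/andP; split; nra.
have [p hp] : exists p : {poly R}, forall x, 0 <= x <= 1 ->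
  `|f (a + (b - a) * x) - p.[x]| <= e.
  have [c _ hc] := EVT_max (ltW ab) fc; have [c' _ hc'] := EVT_min (ltW ab) fc.
  apply: (@weierstrass01 _ (`|f c| + `|f c'|)) => //.
    move=> x /rg; set y := a + _ => hy.
    have := hc y; have := hc' y; rewrite in_itv /= hy => /(_ isT) h1 /(_ isT) h2.
    have := ler_norm (f c); have := ler_norm (- f c'); rewrite normrN.
    have := normr_ge0 (f c); have := normr_ge0 (f c').
    by rewrite ler_norml; lra.
  move=> k k0; have [d d0 hd] := continuous_ucont_on fc k0.
  exists (d / (b - a)); first by rewrite divr_gt0.
  move=> x y /rg hx /rg hy; rewrite ltr_pdivlMr// => xy; apply: hd => //.
  by rewrite opprD addrACA subrr add0r -mulrBr normrM (gtr0_norm ab0) mulrC.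
exists (p \Po ((b - a)^-1%:P * ('X - a%:P))) => x /andP[ax xb].
rewrite horner_comp !hornerE.
have -> : f x = f (a + (b - a) * ((b - a)^-1 * (x - a))).
  by rewrite mulrA divff ?gt_eqF// mul1r addrC subrK.
apply: hp; apply/andP; split;
  first by rewrite mulr_ge0 ?invr_ge0 ?subr_ge0 ?(ltW ab).
by rewrite mulrC ler_pdivrMr// mul1r lerB.
Qed.

End Weierstrass.

(** * Continuous functional calculus *)

Section FunctionalCalculus.
Context {R : realType} {H : hilbertType R}.
Local Notation Id := (1 : bop H).
Implicit Types (x y z : H) (S T X Y D : bop H) (a b c d e : R) (p q : {poly R[i]}).
Implicit Types f g : R -> R.

Lemma opnorm_triB S T (u v : R) :
  opnorm S <= u -> opnorm T <= v -> opnorm (S - T) <= u + v.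
Proof.
by move=> hu hv; rewrite (le_trans (opnorm_tri _ _))// opnormN lerD.
Qed.

(** AM-GM with weight [e^-1] on [D x] replaces Cauchy-Schwarz and keeps the bound free of square
    roots. *)
Lemma rdot_small D e x y : 0 < e -> opnorm D <= e ->
  `|rdot (D x) y| <= e * (rdot x x + rdot y y).
Proof.
move=> e0 De.
have h : rdot (D x) (D x) <= e ^+ 2 * rdot x x.
  rewrite (le_trans (rdot_bop_le D x))// ler_wpM2r ?rdot_ge0//.
  by rewrite lerXn2r ?nnegrE ?opnorm_ge0// ltW.
have x0 := rdot_ge0 x; have y0 := rdot_ge0 y.
have := rdot_AMGM (D x) y (r := e^-1); rewrite invr_gt0 => /(_ e0) h1.
have := rdot_AMGM (D x) (- y) (r := e^-1); rewrite invr_gt0 => /(_ e0).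
rewrite !rdotE invrK opprK in h1 * => h2.
have h3 : e^-1 * rdot (D x) (D x) <= e * rdot x x.
  by rewrite ler_pdivrMl// mulrA -expr2.
have : 0 <= e * rdot x x by rewrite mulr_ge0// ltW.
have : 0 <= e * rdot y y by rewrite mulr_ge0// ltW.
rewrite ler_norml; lra.
Qed.

Lemma le0_of_small (a : R) c : 0 <= c -> (forall e, 0 < e -> a <= e * c) -> a <= 0.
Proof.
move=> c0 h; apply/ler_addgt0Pr => e e0; rewrite add0r.
have c1 : 0 < c + 1 by rewrite ltr_wpDl.
apply: le_trans (h (e / (c + 1)) _) _; first by rewrite divr_gt0.
by rewrite mulrAC ler_pdivrMr// ler_wpM2l ?(ltW e0)// lerDl.
Qed.

Lemma sym_closed X :
  (forall e, 0 < e -> exists2 S, op_sym S & opnorm (X - S) <= e) -> op_sym X.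
Proof.
move=> h x y; apply/eqP; rewrite -subr_eq0 -normr_le0.
apply: (@le0_of_small _ (2 * (rdot x x + rdot y y))).
  by rewrite mulr_ge0// addr_ge0 ?rdot_ge0.
move=> e e0; have [S sS XS] := h e e0.
have := rdot_small x y e0 XS; have := rdot_small y x e0 XS.
rewrite !bopE !rdotE (sS x y) (rdotC (S y)) (rdotC (X y)).
rewrite [rdot y y + _]addrC mulrCA.
move: (e * _) => k; rewrite !ler_norml; lra.
Qed.

(** The slack [e] in the bounds admits approximants that satisfy them only nearly, such as
    polynomials in an operator. *)
Lemma between_closed X c d :
  (forall e, 0 < e -> exists2 S,
    op_between (c - e) (d + e) S & opnorm (X - S) <= e) ->
  op_between c d X.
Proof.
move=> h; split=> [|x].
  by apply: sym_closed => e /h[S [sS _] XS]; exists S.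
have h1 e : 0 < e -> (c - 3 * e) * rdot x x <= rdot (X x) x <= (d +
  3 * e) * rdot x x.
  move=> e0; have [S [_ /(_ x) hS] XS] := h e e0.
  have := rdot_small x x e0 XS; rewrite !bopE !rdotE ler_norml.
  by move: hS => /andP[]; lra.
have x0 := rdot_ge0 x.
apply/andP; split; rewrite -subr_le0; apply: (@le0_of_small _ (3 * rdot x x)).
- by rewrite mulr_ge0.
- by move=> e /h1 /andP[]; lra.
- by rewrite mulr_ge0.
- by move=> e /h1 /andP[]; lra.
Qed.

Lemma op_horner_between p T a b c d : op_between a b T -> map_poly conjc p = p ->
  (forall x : R, a <= x <= b -> c%:C <= p.[x%:C] <= d%:C) ->
    op_between c d (op_horner p T).
Proof.
move=> hT pr hp; split; first exact: op_horner_sym hT.1 pr.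
have sp (t : R) : op_spectrum T t%:C -> a <= t <= b.
  by move=> /(between_spectrum hT)[u [->]].
move=> x; apply/andP; split.
  have := op_horner_pos hT (p := p - c%:C%:P) _ _ x.
  rewrite op_hornerB op_hornerC !bopE !rdotE subr_ge0; apply.
    by rewrite rmorphB /= map_poly_conjC pr.
  by move=> t /sp /hp /andP[h _]; rewrite hornerD hornerN hornerC subr_ge0.
have := op_horner_pos hT (p := d%:C%:P - p) _ _ x.
rewrite op_hornerB op_hornerC !bopE !rdotE subr_ge0; apply.
  by rewrite rmorphB /= map_poly_conjC pr.
by move=> t /sp /hp /andP[_ h]; rewrite hornerD hornerN hornerC subr_ge0.
Qed.

Lemma poly_approx a b f : {within `[a, b], continuous f} -> forall e, 0 < e ->
  exists p : {poly R[i]}, map_poly conjc p = p /\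
    forall x : R, a <= x <= b -> exists2 u : R, p.[x%:C] = u%:C & `|f x - u| <= e.
Proof.
move=> fc e e0; have [p hp] := weierstrass fc e0.
exists (map_poly (real_complex R) p); split.
  rewrite -map_poly_comp; apply: eq_map_poly => t /=.
  by apply/eqP; rewrite eq_complex /= oppr0 !eqxx.
by move=> x xab; exists p.[x]; [rewrite horner_map|exact: hp].
Qed.

(** [X] and [Y] are each within [e] of polynomials in [T] that differ by at most [2 e] on the
    spectrum, so they are within [4 e] of each other. *)
Lemma is_cfc_unique a b T f X Y :
  op_between a b T -> is_cfc f T X -> is_cfc f T Y -> X = Y.
Proof.
move=> hT hX hY; apply/eqP; rewrite -subr_eq0; apply/eqP/opnorm_eq0.
congr (_%:C); apply/le_anti; rewrite opnorm_ge0 andbT.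
apply: (@le0_of_small _ 4) => // e e0.
have [p [hp1 hp2]] := hX e e0; have [q [hq1 hq2]] := hY e e0.
have h : opnorm (op_horner (p - q) T) <= e + e.
  apply: (op_horner_opnorm hT) => [|t ht]; first by rewrite addr_ge0// ltW.
  rewrite hornerD hornerN -(subrKA (f t)%:C) rmorphD.
  by rewrite (le_trans (ler_normD _ _))// lerD ?hq1// distrC hp1.
move: hp2 hq2; rewrite /Num.norm /= !lecR => hp2 hq2.
rewrite (_ : X - Y = (X - op_horner p T) +
  op_horner (p - q) T - (Y - op_horner q T)); last first.
  by rewrite op_hornerB addrA subrK opprB addrA subrK.
apply: le_trans (opnorm_triB (le_trans (opnorm_tri _ _) (lerD hp2 h)) hq2) _.
by lra.
Qed.

Lemma cfcE a b T f X : op_between a b T -> is_cfc f T X -> cfc f T = X.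
Proof.
move=> hT hX; rewrite /cfc; apply: (is_cfc_unique hT _ hX).
by apply: xgetPex; exists X.
Qed.

(** Existence of the limit, without which [cfc] would be its default 0: Weierstrass polynomials with
    error [1 / (n + 1)] form a Cauchy sequence in norm. *)
Lemma cfcP a b T f : op_between a b T -> {within `[a, b], continuous f} ->
  is_cfc f T (cfc f T).
Proof.
move=> hT fc; rewrite /cfc; apply: xgetPex.
have ip (n : nat) : 0 < n.+1%:R^-1 :> R by rewrite invr_gt0 ltr0n.
have /choice[p hp] := fun n => poly_approx fc (ip n).
have hpS n (t : R) : op_spectrum T t%:C ->
  `|(f t)%:C - (p n).[t%:C]| <= (n.+1%:R^-1)%:C.
  move=> /(between_spectrum hT)[u /complexI <-] /((hp n).2 _)[v -> h].
  by rewrite -rmorphB normc_def /= expr0n addr0 sqrtr_sqr lecR.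
have inv_small e : 0 < e -> exists N, forall n, (N <= n)%N -> n.+1%:R^-1 <= e.
  move=> e0; exists (Num.truncn e^-1) => n Nn.
  rewrite -[e]invrK lef_pV2 ?posrE ?invr_gt0// ?ltr0n//.
  apply: ltW; apply: lt_le_trans (truncnS_gt _) _.
  by rewrite ler_nat ltnS.
have pp m n : opnorm (op_horner (p m) T - op_horner (p n) T) <= m.+1%:R^-1 +
  n.+1%:R^-1.
  rewrite -op_hornerB; apply: (op_horner_opnorm hT) => [|t ht].
    by rewrite addr_ge0// ltW.
  rewrite hornerD hornerN -(subrKA (f t)%:C) rmorphD.
  by rewrite (le_trans (ler_normD _ _))// lerD ?hpS// distrC hpS.
have [L hL] : exists L, op_cvg (fun n => op_horner (p n) T) L.
  apply: bop_complete => e e0.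
  have e2 : 0 < e / 2 by rewrite divr_gt0.
  have [N hN] := inv_small _ e2; exists N => m n Nm Nn.
  by rewrite (le_trans (pp m n))// [leRHS]splitr lerD ?hN.
exists L => e e0; have [N hN] := hL e e0; have [N' hN'] := inv_small e e0.
exists (p (maxn N N')); split.
  move=> t ht; rewrite (le_trans (hpS _ _ ht))// lecR hN'// leq_maxr//.
by rewrite /Num.norm /= lecR -opnormN opprB hN// leq_maxl.
Qed.

Lemma cfc_approx a b T f p e : op_between a b T -> {within `[a, b], continuous f} ->
  (forall x : R, a <= x <= b -> `|(f x)%:C - p.[x%:C]| <= e%:C) -> 0 <= e ->
  opnorm (cfc f T - op_horner p T) <= e.
Proof.
move=> hT fc hp e0; rewrite -subr_le0; apply: (@le0_of_small _ 2) => // d d0.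
have [q [hq1 hq2]] := cfcP hT fc d0.
move: hq2; rewrite /Num.norm /= lecR => hq2.
have h : opnorm (op_horner (q - p) T) <= d + e.
  apply: (op_horner_opnorm hT) => [|t ht]; first by rewrite addr_ge0// ltW.
  rewrite hornerD hornerN -(subrKA (f t)%:C) rmorphD.
  rewrite (le_trans (ler_normD _ _))// lerD//; first by rewrite distrC hq1.
  by have [u /complexI -> hu] := between_spectrum hT ht; apply: hp.
rewrite (_ : cfc f T - _ = (cfc f T - op_horner q T) + op_horner (q - p) T);
  last first.
  by rewrite op_hornerB addrA subrK.
by rewrite lerBlDr; apply: le_trans (opnorm_tri _ _) (le_trans (lerD hq2 h) _); lra.
Qed.

Lemma norm_real_complex (t : R) : `|t%:C| = `|t|%:C :> R[i].
Proof. by rewrite normc_def /= expr0n addr0 sqrtr_sqr. Qed.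

Lemma cfc_dist a b T f g e : op_between a b T -> {within `[a, b], continuous f} ->
  {within `[a, b], continuous g} -> 0 <= e ->
  (forall x : R, a <= x <= b -> `|f x - g x| <= e) ->
  opnorm (cfc f T - cfc g T) <= e.
Proof.
move=> hT fc gc e0 fg; rewrite -subr_le0; apply: (@le0_of_small _ 2) => // d d0.
have [p [_ hp]] := poly_approx fc d0.
have h1 : opnorm (cfc f T - op_horner p T) <= d.
  apply: (cfc_approx hT fc) (ltW d0) => x /hp[u -> h].
  by rewrite -rmorphB norm_real_complex lecR.
have h2 : opnorm (cfc g T - op_horner p T) <= e + d.
  apply: (cfc_approx hT gc) => [x xab|]; last by rewrite addr_ge0// ltW.
  have [u -> h] := hp x xab; have := fg x xab.
  rewrite -rmorphB norm_real_complex lecR; have := ler_normD (g x - f x) (f x - u).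
  by rewrite addrA subrK (distrC (g x) (f x)); lra.
rewrite (_ : cfc f T - _ = (cfc f T - op_horner p T) - (cfc g T - op_horner p
  T)); last first.
  by rewrite opprB addrA subrK.
rewrite lerBlDr (le_trans (opnorm_triB h1 h2))// le_eqVlt.
by apply/orP; left; apply/eqP; ring.
Qed.

Lemma cfc_between a b T f c d : op_between a b T ->
  {within `[a, b], continuous f} ->
  (forall x : R, a <= x <= b -> c <= f x <= d) -> op_between c d (cfc f T).
Proof.
move=> hT fc fb; apply: between_closed => e e0.
have [p [pr hp]] := poly_approx fc e0.
exists (op_horner p T).
  apply: (op_horner_between hT pr) => x xab; have [u -> h] := hp x xab.
  have := fb x xab; move: h; rewrite !lecR ler_norml.
  by move=> /andP[? ?] /andP[? ?]; apply/andP; split; lra.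
apply: (cfc_approx hT fc) (ltW e0) => x /hp[u -> h].
by rewrite -rmorphB norm_real_complex lecR.
Qed.

Lemma cfc_id a b T : op_between a b T -> cfc id T = T.
Proof.
move=> hT; apply: (cfcE hT) => e e0; exists 'X; split=> [x _|].
  by rewrite hornerX subrr normr0 lecR ltW.
by rewrite op_hornerX subrr normr0 lecR ltW.
Qed.

Lemma cfc_cst a b T c : op_between a b T -> cfc (fun=> c) T = c%:C *: Id.
Proof.
move=> hT; apply: (cfcE hT) => e e0; exists c%:C%:P; split=> [x _|].
  by rewrite hornerC subrr normr0 lecR ltW.
by rewrite op_hornerC subrr normr0 lecR ltW.
Qed.

Lemma cfc_ext a b T f g : op_between a b T -> {within `[a, b], continuous g} ->
  (forall x : R, a <= x <= b -> f x = g x) -> cfc f T = cfc g T.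
Proof.
move=> hT gc fg; apply: (cfcE hT) => e e0.
have [p [h1 h2]] := cfcP hT gc e0; exists p; split=> // t ht.
have [u /complexI e1 hu] := between_spectrum hT ht.
by rewrite e1 fg// -e1 h1.
Qed.

Lemma continuous_bounded a b f : {within `[a, b], continuous f} ->
  exists2 M : R, 0 <= M & forall x : R, a <= x <= b -> `|f x| <= M.
Proof.
move=> fc; have [ab|ba] := leP a b; last first.
  by exists 0 => // x /andP[h1 h2]; have := lt_le_trans ba (le_trans h1 h2);
    rewrite ltxx.
have [c _ hc] := EVT_max ab fc; have [c' _ hc'] := EVT_min ab fc.
exists (`|f c| + `|f c'|); first by rewrite addr_ge0.
move=> y hy; have := hc y; have := hc' y;
  rewrite in_itv /= hy => /(_ isT) h1 /(_ isT) h2.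
have := ler_norm (f c); have := ler_norm (- f c'); rewrite normrN.
have := normr_ge0 (f c); have := normr_ge0 (f c').
by rewrite ler_norml; lra.
Qed.

Lemma cfcM a b T f g : op_between a b T -> {within `[a, b], continuous f} ->
  {within `[a, b], continuous g} ->
    cfc (fun x : R => f x * g x) T = cfc f T * cfc g T.
Proof.
move=> hT fc gc; apply: (cfcE hT) => e e0.
have [Mf Mf0 hf] := continuous_bounded fc;
  have [Mg Mg0 hg] := continuous_bounded gc.
(* [d <= 1] bounds the approximants of [g] by [Mg + 1] and [opnorm (cfc g T) + 1]. [K] then
   dominates the error factor both for the scalar functions and for the operators. *)
pose K := Mf + Mg + opnorm (cfc f T) + opnorm (cfc g T) + 1.
have F0 := opnorm_ge0 (cfc f T); have G0 := opnorm_ge0 (cfc g T).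
have K0 : 0 < K by rewrite /K; lra.
pose d := Num.min 1 (e / K).
have d0 : 0 < d by rewrite lt_min ltr01 divr_gt0.
have d1 : d <= 1 by rewrite ge_min lexx.
have dK : K * d <= e by rewrite mulrC -ler_pdivlMr// ge_min lexx orbT.
have [p [_ hp]] := poly_approx fc d0; have [q [_ hq]] := poly_approx gc d0.
have hpT : opnorm (cfc f T - op_horner p T) <= d.
  apply: (cfc_approx hT fc) (ltW d0) => x /hp[u -> h].
  by rewrite -rmorphB norm_real_complex lecR.
have hqT : opnorm (cfc g T - op_horner q T) <= d.
  apply: (cfc_approx hT gc) (ltW d0) => x /hq[u -> h].
  by rewrite -rmorphB norm_real_complex lecR.
exists (p * q); split.
  move=> t ht; have [_ /complexI <- tab] := between_spectrum hT ht.
  have [u pu hu] := hp _ tab; have [v qv hv] := hq _ tab.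
  rewrite hornerM pu qv -rmorphM -rmorphB norm_real_complex lecR.
  apply: le_trans dK.
  have -> : f t * g t - u * v = (f t - u) * v + f t * (g t - v) by ring.
  apply: le_trans (ler_normD _ _) _; rewrite !normrM.
  have hv' : `|v| <= Mg + 1.
    have := ler_normD (g t) (v - g t); rewrite addrC subrK distrC.
    by have := hg _ tab; lra.
  have : `|f t - u| * `|v| <= d * (Mg + 1) by rewrite ler_pM.
  have : `|f t| * `|g t - v| <= Mf * d by rewrite ler_pM// hf.
  have : 0 <= d * opnorm (cfc f T) by rewrite mulr_ge0// ltW.
  have : 0 <= d * opnorm (cfc g T) by rewrite mulr_ge0// ltW.
  by rewrite /K; lra.
rewrite /Num.norm /= lecR op_hornerM; apply: le_trans dK.
set P := op_horner p T in hpT *; set Q := op_horner q T in hqT *.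
have -> : cfc f T * cfc g T - P * Q = (cfc f T - P) * Q + cfc f T * (cfc g T - Q).
  by rewrite mulrBl mulrBr [RHS]addrC addrA subrK.
apply: le_trans (opnorm_tri _ _) _.
have hQ : opnorm Q <= opnorm (cfc g T) + 1.
  rewrite -[Q](subrK (cfc g T)) addrC (le_trans (opnorm_tri _ _))// lerD2l.
  by rewrite -opnormN opprB (le_trans hqT).
have : opnorm (cfc f T - P) * opnorm Q <= d * (opnorm (cfc g T) + 1).
  by rewrite ler_pM ?opnorm_ge0.
have : opnorm (cfc f T) * opnorm (cfc g T - Q) <= opnorm (cfc f T) * d.
  by rewrite ler_pM ?opnorm_ge0.
have := opnormM (cfc f T - P) Q; have := opnormM (cfc f T) (cfc g T - Q).
have : 0 <= d * Mf by rewrite mulr_ge0// ltW.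
have : 0 <= d * Mg by rewrite mulr_ge0// ltW.
by rewrite /K; lra.
Qed.

(** The norm bound [B] feeds the induction: [P S - Q T = (P - Q) S + Q (S - T)] requires control of
    [Q]. *)
Lemma op_horner_lipschitz p (K : R) : 0 <= K -> exists L B : R, [/\ 0 <= L, 0 <= B &
  forall S T, opnorm S <= K -> opnorm T <= K ->
   opnorm (op_horner p S) <= B /\ opnorm (op_horner p S - op_horner p T) <= L *
     opnorm (S - T)].
Proof.
move=> K0; elim/poly_ind: p => [|p c [L [B [L0 B0 h]]]].
  by exists 0, 0; split=> // S T _ _; rewrite !op_horner0 subrr mul0r opnorm0.
exists (L * K + B), (B * K + opnorm (c *: Id)); split.
- by rewrite addr_ge0 ?mulr_ge0.
- by rewrite addr_ge0 ?mulr_ge0 ?opnorm_ge0.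
move=> S T hS hT; have [h1 h2] := h S T hS hT; have [h3 _] := h T T hT hT.
rewrite !op_hornerD !op_hornerMX !op_hornerC; split.
  rewrite (le_trans (opnorm_tri _ _))// lerD// (le_trans (opnormM _ _))//.
  by rewrite ler_pM ?opnorm_ge0.
set P := op_horner p S; set Q := op_horner p T.
have -> : P * S + c *: Id - (Q * T + c *: Id) = (P - Q) * S + Q * (S - T).
  by rewrite opprD addrACA subrr addr0 mulrBl mulrBr addrA subrK.
rewrite (le_trans (opnorm_tri _ _))// [leRHS]mulrDl lerD//
  (le_trans (opnormM _ _))//.
  by rewrite [leRHS]mulrAC ler_pM ?opnorm_ge0.
by rewrite ler_wpM2r ?opnorm_ge0.
Qed.

Lemma between_opnorm_le a b T : op_between a b T -> opnorm T <= `|a| + `|b|.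
Proof.
move=> hT; apply: between_opnorm; first by rewrite addr_ge0.
have := ler_norm (- a); have := ler_norm b; rewrite normrN.
have := normr_ge0 a; have := normr_ge0 b => h1 h2 h3 h4.
by apply: between_le hT; lra.
Qed.

(** A single polynomial approximates [f] on [[a, b]], hence [f(T)] for all [T] between [a] and [b]
    at once; its Lipschitz constant gives a [d] independent of [S] and [T]. *)
Lemma cfc_cont a b f : {within `[a, b], continuous f} -> forall e, 0 < e ->
  exists2 d, 0 < d & forall S T, op_between a b S -> op_between a b T ->
    opnorm (S - T) <= d -> opnorm (cfc f S - cfc f T) <= e.
Proof.
move=> fc e e0; have e4 : 0 < e / 4 by rewrite divr_gt0.
have [p [_ hp]] := poly_approx fc e4.
have hpT T : op_between a b T -> opnorm (cfc f T - op_horner p T) <= e / 4.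
  move=> hT; apply: (cfc_approx hT fc) (ltW e4) => x /hp[u -> h].
  by rewrite -rmorphB norm_real_complex lecR.
have [|L [B [L0 _ hL]]] := @op_horner_lipschitz p (`|a| + `|b|).
  by rewrite addr_ge0.
have L1 : 0 < L + 1 by rewrite ltr_wpDl.
exists (e / 4 / (L + 1)); first by rewrite divr_gt0.
move=> S T hS hT ST.
have [_ h] := hL S T (between_opnorm_le hS) (between_opnorm_le hT).
have h' : L * opnorm (S - T) <= e / 4.
  move: ST; rewrite ler_pdivlMr// => ST; apply: le_trans ST.
  by rewrite mulrC ler_wpM2l ?opnorm_ge0// lerDl.
have -> : cfc f S - cfc f T = (cfc f S - op_horner p S) +
  (op_horner p S - op_horner p T) - (cfc f T - op_horner p T).
  by rewrite addrA subrK opprB addrA subrK.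
apply: le_trans (opnorm_triB (le_trans (opnorm_tri _ _) _) (hpT T hT)) _.
  exact: lerD (hpT S hS) (le_trans h h').
by lra.
Qed.

End FunctionalCalculus.

(** * Powers and geometric means *)

Section InversePair.
Context {A : pzRingType} (S P : A).
Hypotheses (SP : S * P = 1) (PS : P * S = 1).
Implicit Types X Y Z D V : A.

(** In the applications [S] and [P] are the powers 1/2 and -1/2 of one operator. *)
Lemma conjK X : S * (P * X * P) * S = X.
Proof. by rewrite -!mulrA PS mulr1 mulrA SP mul1r. Qed.

Lemma conj_sqr X : (P * X * P) * (P * X * P) = P * (X * (P * P) * X) * P.
Proof. by rewrite !mulrA. Qed.

Lemma conj_mul2 X Y : (P * X * P) * (S * Y * S) = P * (X * Y) * S.
Proof. by rewrite -!mulrA (mulrA P S) PS mul1r. Qed.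

Lemma conj_mul3 X Y Z : S * X * S * (P * Y * P) * (S * Z * S) = S * (X * Y * Z) * S.
Proof. by rewrite -!mulrA (mulrA S P) SP mul1r (mulrA P S) PS mul1r. Qed.

(** When [S * S = U] and [D] is the square root of [P V P], [S D S] is the mean of [U] and [V] and
    [P * P] is the inverse of [U]: this is the Riccati equation. *)
Lemma conj_riccati D V : D * D = P * V * P -> S * D * S * (P * P) * (S * D * S) = V.
Proof. by move=> DD; rewrite -[X in _ * (X * P)]mulr1 conj_mul3 mulr1 DD conjK. Qed.

End InversePair.

Section GeometricMean.
Context {R : realType} {H : hilbertType R}.
Local Notation Id := (1 : bop H).
Implicit Types (x y z : H) (S P T X Y D A B C G U V : bop H).
Implicit Types a b c d e m M r s t : R.

Lemma powR_cont t a b : 0 < a -> {within `[a, b], continuous (fun x : R => x `^ t)}.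
Proof.
move=> a0; apply: derivable_within_continuous => x;
  rewrite in_itv /= => /andP[ax _].
by apply: derivable_powR; rewrite in_itv /= andbT (lt_le_trans a0).
Qed.

(* Locked: otherwise unification unfolds the functional calculus when it compares
   two different powers. *)
Fact op_pow_key : unit. Proof. by []. Qed.
Definition op_pow t T : bop H :=
  locked_with op_pow_key (cfc (fun x : R => x `^ t) T).

Lemma op_powE t T : op_pow t T = cfc (fun x : R => x `^ t) T.
Proof. by rewrite /op_pow unlock. Qed.

Lemma op_powD c d T s t : 0 < c -> op_between c d T ->
  op_pow s T * op_pow t T = op_pow (s + t) T.
Proof.
move=> c0 hT; rewrite !op_powE -(cfcM hT); try exact: powR_cont.
apply: (cfc_ext hT); first exact: powR_cont.
by move=> x /andP[cx _]; rewrite powRD// (gt_eqF (lt_le_trans c0 cx)) implybT.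
Qed.

Lemma op_pow0 c d T : 0 < c -> op_between c d T -> op_pow 0 T = 1.
Proof.
move=> c0 hT; rewrite -[RHS](scale1r Id) -[1](rmorph1 (real_complex R)) -(cfc_cst
  1 hT) op_powE.
by congr cfc; apply/funext => x; rewrite powRr0.
Qed.

Lemma op_pow1 c d T : 0 < c -> op_between c d T -> op_pow 1 T = T.
Proof.
move=> c0 hT; rewrite -[RHS](cfc_id hT) op_powE; apply: (cfc_ext hT).
  exact: (@derivable_within_continuous _ _ idfun).
by move=> x /andP[cx _]; rewrite powRr1// (le_trans (ltW c0)).
Qed.

Lemma continuous_pos_bounds a b (f : R -> R) : a <= b ->
  {within `[a, b], continuous f} ->
  (forall x : R, a <= x <= b -> 0 < f x) ->
  exists c d, [/\ 0 < c, c <= d & forall x : R, a <= x <= b -> c <= f x <= d].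
Proof.
move=> ab fc fp; have [v hv h1] := EVT_max ab fc; have [u hu h2] := EVT_min ab fc.
exists (f u), (f v); split.
- by apply: fp; move: hu; rewrite in_itv.
- exact: h1.
- by move=> x hx; rewrite h1 ?h2// in_itv.
Qed.

(** The bounds are chosen before [T], so that they serve a whole family of operators. *)
Lemma op_pow_bounds t c d : 0 < c -> c <= d ->
  exists u v, [/\ 0 < u, u <= v & forall T, op_between c d T ->
    op_between u v (op_pow t T)].
Proof.
move=> c0 cd.
have [x /andP[cx _]|u [v [u0 uv h]]] :=
  continuous_pos_bounds cd (@powR_cont t c d c0).
  by rewrite powR_gt0// (lt_le_trans c0).
by exists u, v; split=> // T hT; rewrite op_powE; apply: (cfc_between hT);
  [exact: powR_cont|].
Qed.

Lemma op_pow_sym t c d T : 0 < c -> op_between c d T -> op_sym (op_pow t T).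
Proof.
move=> c0 hT; have fc := @powR_cont t c d c0.
have [M _ hM] := continuous_bounded fc; rewrite op_powE.
have [] // := @cfc_between _ _ c d T _ (- M) M hT fc _.
by move=> x /hM; rewrite ler_norml.
Qed.

Lemma op_powN_between c d T : 0 < c -> op_between c d T ->
  op_between d^-1 c^-1 (op_pow (- 1) T).
Proof.
move=> c0 hT; rewrite op_powE; apply: (cfc_between hT); first exact: powR_cont.
move=> x /andP[cx xd]; have x0 := lt_le_trans c0 cx.
rewrite powR_inv1 ?(ltW x0)// !lef_pV2 ?posrE//; first by rewrite cx xd.
exact: lt_le_trans xd.
Qed.

(** Write [x^s = exp(s ln x)]: the arguments of [exp] stay in [[-K, K]], where it is uniformly
    continuous, and they move by at most [K |s - t|]. *)
Lemma op_pow_cont c d : 0 < c -> c <= d -> forall e, 0 < e -> exists2 r : R, 0 < r &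
  forall s t T, 0 <= s <= 1 -> 0 <= t <= 1 -> `|s - t| < r -> op_between c d T ->
  opnorm (op_pow s T - op_pow t T) <= e.
Proof.
move=> c0 cd e e0.
pose K : R := `|ln c| + `|ln d| + 1.
have K0 : 0 < K by rewrite ltr_wpDl// addr_ge0.
have lK (x : R) : c <= x <= d -> `|ln x| <= K.
  move=> /andP[cx xd]; have x0 := lt_le_trans c0 cx; have d0 := lt_le_trans x0 xd.
  have : ln c <= ln x by rewrite ler_ln ?posrE.
  have : ln x <= ln d by rewrite ler_ln ?posrE.
  rewrite /K ler_norml; have := ler_norm (ln d); have := ler_norm (- ln c).
  have := normr_ge0 (ln c); have := normr_ge0 (ln d); rewrite normrN; lra.
have [|r r0 hr] := @continuous_ucont_on R (- K) K expR _ e e0.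
  apply: derivable_within_continuous => x _.
  by have [] := is_derive_expR x.
exists (r / K); first by rewrite divr_gt0.
move=> s t T /andP[s0 s1] /andP[t0 t1] st hT.
rewrite !op_powE; apply: (cfc_dist hT);
  [exact: powR_cont|exact: powR_cont|exact: ltW|].
move=> x cxd; have /andP[cx _] := cxd; have x0 := lt_le_trans c0 cx.
have h u : 0 <= u -> u <= 1 -> - K <= u * ln x <= K.
  move=> u0 u1; rewrite -ler_norml normrM (ger0_norm u0).
  by rewrite (le_trans _ (lK x cxd))// ler_piMl.
rewrite /powR !gt_eqF//; apply: hr; try exact: h.
rewrite -mulrBl normrM; move: st; rewrite ltr_pdivlMr//; apply: le_lt_trans.
by rewrite ler_wpM2l// lK.
Qed.

Lemma between_conj u v c d S T : op_sym S -> 0 <= c -> 0 <= d ->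
  op_between u v (S * S) ->
  op_between c d T -> op_between (c * u) (d * v) (S * T * S).
Proof.
move=> sS c0 d0 [_ hS] [sT hT]; split; first exact: sym_conj.
move=> x; have /andP[h1 h2] := hS x; have /andP[h3 h4] := hT (S x).
move: h1 h2; rewrite !bopE !sS -!mulrA -sS => h1 h2; apply/andP; split.
  by apply: le_trans h3; rewrite ler_wpM2l.
by apply: le_trans h4 _; rewrite ler_wpM2l.
Qed.

Lemma op_pow_half c d U : 0 < c -> op_between c d U ->
  let S := op_pow 2^-1 U in let P := op_pow (- 2^-1) U in
  [/\ op_sym S, op_sym P, S * P = 1,
    P * S = 1 & S * S = U /\ P * P = op_pow (- 1) U].
Proof.
move=> c0 hU S P; split; try exact: op_pow_sym hU.
- by rewrite (op_powD _ _ c0 hU) subrr (op_pow0 c0 hU).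
- by rewrite (op_powD _ _ c0 hU) addNr (op_pow0 c0 hU).
- have h : 2^-1 + 2^-1 = 1 :> R by lra.
  by rewrite !(op_powD _ _ c0 hU) -opprD h (op_pow1 c0 hU).
Qed.

(* Let m be the infimum of the form of D - Y. If m < 0, substituting
   Y = E - Z with Z = D - Y - m >= 0 and E = D - m in Y^2 <= D^2 bounds Z below. *)
Lemma sqrt_mono Y D d : op_sym Y -> op_between 0 d D ->
  form_le (Y * Y) (D * D) -> form_le Y D.
Proof.
move=> sY [sD hD] hYD x; have [->|x0] := eqVneq x 0; first by rewrite !bop0.
have sK : op_sym (D - Y) by exact: symB.
have [m [h1 h2]] := sym_inf sK (ex_intro _ x x0).
suff m0 : 0 <= m.
  have := h1 x; rewrite bopE bopNE !rdotE => h.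
  by rewrite -subr_ge0 (le_trans _ h)// mulr_ge0 ?rdot_ge0.
rewrite leNgt; apply/negP => m0.
pose Z := D - Y - m%:C *: Id.
have sZ : op_sym Z by apply: symB => //; apply: symZ; exact: sym1.
have ZE y : rdot (Z y) y = rdot ((D - Y) y) y - m * rdot y y.
  by rewrite /Z [in LHS]bopDE bopNE bopZE bop1E rdotDl rdotNl rdotZl.
have bZ : op_between 0 (opnorm Z + 1) Z.
  split=> // y; rewrite mul0r ZE subr_ge0 h1 -ZE.
  by have [_ /(_ y)/andP[]] := sym_between sZ (ler_wpDr ler01 (lexx _)).
pose E := D - m%:C *: Id.
have sE : op_sym E by apply: symB => //; apply: symZ; exact: sym1.
pose K := opnorm E ^+ 2 + 1.
have K0 : 0 < K by rewrite ltr_wpDl ?exprn_ge0 ?opnorm_ge0.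
(* As [D >= 0] and [m < 0], [|E y|^2] exceeds [|D y|^2] by at least [m^2 |y|^2]. This [r] makes
   [r |E y|^2 <= m^2 / 2 |y|^2], so half of that gain survives AM-GM on [2 <E y, Z y>]. *)
pose r := m ^+ 2 / (2 * K).
have m20 : 0 < m ^+ 2 by rewrite exprn_even_gt0//= lt_eqF.
have r0 : 0 < r by rewrite divr_gt0// mulr_gt0.
have YE y : Y y = E y - Z y.
  have -> : E = Y + Z by rewrite /Z [Y + _]addrC addrAC subrK.
  by rewrite bopE addrK.
have EE y : rdot (E y) (E y) =
    rdot (D y) (D y) - 2 * m * rdot (D y) y + m ^+ 2 * rdot y y.
  by rewrite /E !bopE !rdotE (rdotC y); ring.
clearbody E Z.
have key y : m ^+ 2 / 2 * r * rdot y y <= rdot (Z y) (Z y).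
  have := hYD y; rewrite !bopME sY sD YE !rdotE (rdotC (Z y)) => h.
  have := rdot_AMGM (E y) (Z y) r0.
  have D0 : 0 <= rdot (D y) y by have /andP[] := hD y; rewrite mul0r.
  have mD : m * rdot (D y) y <= 0 by rewrite mulr_le0_ge0// ltW.
  have hE : r * rdot (E y) (E y) <= m ^+ 2 / 2 * rdot y y.
    have h5 : rdot (E y) (E y) <= K * rdot y y.
      by rewrite (le_trans (rdot_bop_le E y))// ler_wpM2r ?rdot_ge0// lerDl.
    apply: le_trans (ler_wpM2l (ltW r0) h5) _; rewrite le_eqVlt; apply/orP; left.
    by apply/eqP; rewrite /r; field; rewrite gt_eqF.
  rewrite -mulrA mulrCA.
  have := rdot_ge0 (Z y); move: (EE y) h hE.
  move: (rdot (E y) (E y)) (rdot (D y) (D y)) (rdot (Z y) (Z y)) (rdot (E y) (Z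
    y)) => ee dd zz ez.
  move: (rdot (D y) y) mD (rdot y y) => dy mD yy.
  by move=> h3 h4 h5 h6 h7; rewrite -ler_pdivlMl//; lra.
have c0 : 0 < m ^+ 2 / 2 * r by apply: mulr_gt0 => //; rewrite divr_gt0.
(* A positive lower bound for [Z] would raise [m], already the largest lower bound for [D - Y]. *)
have [k k0 hk] := below_pos bZ c0 key.
have : m + k <= m by apply: h2 => y; rewrite mulrDl -lerBrDl -ZE.
by rewrite gerDl leNgt k0.
Qed.

(** With [x = V y] the claim becomes [V <= V U^-1 V], and [V U^-1 V - V = (V - U) U^-1 (V - U) + (V
    - U)] is a sum of two positive terms. *)
Lemma inv_anti U V G P : op_sym U -> form_le 0 U -> form_le U V -> op_sym V ->
  op_sym G ->
  U * G = 1 -> G * U = 1 -> V * P = 1 -> form_le P G.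
Proof.
move=> sU U0 UV sV sG UG GU VP x.
have GE z : rdot (G z) z = rdot (U (G z)) (G z).
  by rewrite -(bopME U) UG bop1E rdotC.
pose y := P x; have xE : x = V y by rewrite /y -bopME VP.
pose z := V y - U y.
have G0 : 0 <= rdot (G z) z.
  by rewrite GE; have := U0 (G z); rewrite bop0E rdot0l.
have := UV y; rewrite {1}/y -/y => Uy.
have -> : rdot (P x) x = rdot (V y) y by rewrite -/y xE rdotC.
have GVy : G (V y) = y + G z.
  by rewrite /z bopD bopN -[G (U y)]bopME GU bop1E addrC subrK.
rewrite xE GVy rdotDl (rdotC y) lerDl.
have -> : rdot (G z) (V y) = rdot (G z) z + rdot z y.
  rewrite {3}/z rdotDr rdotNr -[rdot (G z) (U y)]sU -bopME UG bop1E /z.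
  by rewrite subrK.
by rewrite addr_ge0// /z !rdotE subr_ge0.
Qed.

Lemma gmeanE t A B : gmean t A B =
  op_pow 2^-1 A * op_pow t (op_pow (- 2^-1) A * B * op_pow (- 2^-1) A) *
    op_pow 2^-1 A.
Proof. by rewrite !op_powE. Qed.

Lemma form_le0_between c d U : 0 <= c -> op_between c d U -> form_le 0 U.
Proof.
move=> c0 [_ hU] x; rewrite bop0E rdot0l; have /andP[h _] := hU x.
by rewrite (le_trans _ h)// mulr_ge0 ?rdot_ge0.
Qed.

Lemma between0_form_le X : op_sym X -> form_le 0 X -> op_between 0 (opnorm X) X.
Proof.
move=> sX X0; split=> // x; have := X0 x; rewrite bop0E rdot0l mul0r => ->.
by have [_ /(_ x)/andP[_ ->]] := sym_between sX (lexx _).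
Qed.

Lemma conj_bounds c d a b A B : 0 < c -> c <= d -> 0 < a -> a <= b ->
  op_between c d A -> op_between a b B ->
  op_between (a * d^-1) (b * c^-1) (op_pow (- 2^-1) A * B * op_pow (- 2^-1) A).
Proof.
move=> c0 cd a0 ab hA hB; have [_ sP _ _ [_ PP]] := op_pow_half c0 hA.
apply: between_conj => //; first exact: ltW; first by rewrite (le_trans (ltW a0)).
by rewrite PP; exact: op_powN_between.
Qed.

Lemma conj_bounds_gt0 a b c d :
  0 < c -> c <= d -> 0 < a -> a <= b -> 0 < a * d^-1 /\ a * d^-1 <= b * c^-1.
Proof.
move=> c0 cd a0 ab; have d0 := lt_le_trans c0 cd; split; first exact: divr_gt0.
by apply: ler_pM; rewrite ?invr_ge0 ?(ltW a0) ?(ltW d0)// lef_pV2.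
Qed.

(** Crude bounds for any real [t], uniform in [A] and [B]; the sharp ones for [0 <= t <= 1] come
    with [gmean_between]. *)
Lemma gmean_bounds t c d a b : 0 < c -> c <= d -> 0 < a -> a <= b ->
  exists u v, [/\ 0 < u, u <= v &
    forall A B, op_between c d A -> op_between a b B ->
      op_between u v (gmean t A B)].
Proof.
move=> c0 cd a0 ab; have [k0 kl] := conj_bounds_gt0 c0 cd a0 ab.
have [u [v [u0 uv h]]] := @op_pow_bounds t _ _ k0 kl.
have v0 := lt_le_trans u0 uv.
exists (u * c), (v * d); split; first exact: mulr_gt0.
  by apply: ler_pM => //; rewrite ltW.
move=> A B hA hB; have [sS _ _ _ [SS _]] := op_pow_half c0 hA.
rewrite gmeanE; apply: between_conj; [exact: sS|exact: ltW u0|exact: ltW v0| |].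
  by rewrite SS.
by apply: h; exact: (conj_bounds c0 cd a0 ab hA hB).
Qed.

(** The Riccati equation says that [P X P] squares to [P V P]. Its positive square root is unique,
    by [sqrt_mono] in both directions. *)
Lemma gmean_half_unique c d a b U V G X : 0 < c -> c <= d -> 0 < a -> a <= b ->
  op_between c d U -> op_between a b V -> op_sym X -> form_le 0 X -> G * U = 1 ->
    X * G * X = V ->
  gmean 2^-1 U V = X.
Proof.
move=> c0 cd a0 ab hU hV sX X0 GU XGX.
have [sS sP SP PS [SS PP]] := op_pow_half c0 hU; rewrite gmeanE.
set S := op_pow 2^-1 U in sS sP SP PS SS PP *;
  set P := op_pow (- 2^-1) U in sP SP PS PP *.
have [k0 kl] := conj_bounds_gt0 c0 cd a0 ab.
have hC := conj_bounds c0 cd a0 ab hU hV; rewrite -/P in hC.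
have [sD _ _ _ [DD _]] := op_pow_half k0 hC.
set D := op_pow 2^-1 _ in sD DD *.
have [u [v [u0 uv hD]]] := @op_pow_bounds 2^-1 _ _ k0 kl.
have {}hD : op_between u v D := hD _ hC.
clearbody D S P.
have GPP : G = P * P.
  have UPP : U * (P * P) = 1 by rewrite -SS -mulrA (mulrA S P) SP mul1r.
  by rewrite -[G]mulr1 -UPP mulrA GU mul1r.
have sY : op_sym (P * X * P) by exact: sym_conj.
have Y0 : form_le 0 (P * X * P).
  by have := form_le_conj sP X0; rewrite mulr0 mul0r.
have YY : (P * X * P) * (P * X * P) = D * D.
  by rewrite conj_sqr -GPP XGX DD.
have YD : P * X * P = D.
  apply: (form_le_anti sY sD).
    by apply: sqrt_mono sY (between_le (ltW u0) (lexx _) hD) _; rewrite YY => x.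
  by apply: sqrt_mono sD (between0_form_le sY Y0) _; rewrite YY => x.
by rewrite -YD; exact: conjK.
Qed.

Lemma gmean_half_riccati c d a b U V : 0 < c -> c <= d -> 0 < a -> a <= b ->
  op_between c d U -> op_between a b V ->
  gmean 2^-1 U V * op_pow (- 1) U * gmean 2^-1 U V = V.
Proof.
move=> c0 cd a0 ab hU hV.
have [sS sP SP PS [SS PP]] := op_pow_half c0 hU; rewrite gmeanE -PP.
have [k0 kl] := conj_bounds_gt0 c0 cd a0 ab.
have hC := conj_bounds c0 cd a0 ab hU hV.
have [_ _ _ _ [DD _]] := op_pow_half k0 hC.
exact: conj_riccati SP PS _ _ DD.
Qed.

Lemma op_powN1_inv c d U : 0 < c -> op_between c d U ->
  op_pow (- 1) U * U = 1 /\ U * op_pow (- 1) U = 1.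
Proof.
move=> c0 hU; rewrite -{2 3}(op_pow1 c0 hU) !(op_powD _ _ c0 hU) subrr addNr.
by rewrite (op_pow0 c0 hU).
Qed.

(* With X = U # V, the Riccati equation and U'^-1 <= U^-1 give
   X U'^-1 X <= X U^-1 X = V <= V', that is (P X P)^2 <= P V' P for P = U'^(-1/2). *)
Lemma gmean_half_mono c d a b U U' V V' : 0 < c -> c <= d -> 0 < a -> a <= b ->
  op_between c d U -> op_between a b V -> op_between c d U' ->
    op_between a b V' -> form_le U U' -> form_le V V' ->
  form_le (gmean 2^-1 U V) (gmean 2^-1 U' V').
Proof.
move=> c0 cd a0 ab hU hV hU' hV' UU' VV'.
have [u [v [u0 uv hX]]] := @gmean_bounds 2^-1 _ _ _ _ c0 cd a0 ab.
have [sX _] := hX _ _ hU hV.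
have Xr := gmean_half_riccati c0 cd a0 ab hU hV.
set X := gmean 2^-1 U V in sX Xr *; clearbody X.
have [GU UG] := op_powN1_inv c0 hU; have [GU' UG'] := op_powN1_inv c0 hU'.
have hG : form_le (op_pow (- 1) U') (op_pow (- 1) U).
  apply: (inv_anti hU.1 (form_le0_between (ltW c0) hU) UU' hU'.1 _ UG GU UG').
  exact: op_pow_sym hU.
have [sS sP SP PS [SS PP]] := op_pow_half c0 hU'; rewrite gmeanE.
set S := op_pow 2^-1 U' in sS SP PS *; set P := op_pow (- 2^-1) U' in sP SP PS PP *.
have [k0 kl] := conj_bounds_gt0 c0 cd a0 ab.
have hC := conj_bounds c0 cd a0 ab hU' hV'; rewrite -/P in hC.
have [_ _ _ _ [DD _]] := op_pow_half k0 hC.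
set D := op_pow 2^-1 _ in DD *.
have [u' [v' [u'0 _ hD]]] := @op_pow_bounds 2^-1 _ _ k0 kl.
have {}hD : op_between u' v' D := hD _ hC.
clearbody D S P.
rewrite -[X](conjK SP PS); apply: form_le_conj; first exact: sS.
apply: sqrt_mono (sym_conj sP sX) (between_le (ltW u'0) (lexx _) hD) _.
rewrite conj_sqr DD; apply: form_le_conj; first exact: sP.
apply: form_le_trans VV'.
rewrite -[X in form_le _ X]Xr PP; apply: form_le_conj; [exact: sX|exact: hG].
Qed.

Lemma between_scalar m : op_between m m (m%:C *: Id).
Proof.
split; first by apply: symZ; exact: sym1.
by move=> x; rewrite bopZE bop1E rdotZl !lexx.
Qed.

Lemma gmean_half_scalar m : 0 < m ->
  gmean 2^-1 (m%:C *: Id) (m%:C *: Id) = m%:C *: Id.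
Proof.
move=> m0; have h := between_scalar m.
apply: (gmean_half_unique (G :=
  (m^-1)%:C *: Id) m0 (lexx _) m0 (lexx _) h h h.1 (form_le0_between (ltW m0) h)).
  by rewrite bop_scaleAl mul1r scalerA -rmorphM mulVf ?gt_eqF// scale1r.
by rewrite bop_scaleAl mul1r scalerA -rmorphM divff ?gt_eqF// scale1r mul1r.
Qed.

Lemma between_form_le m M T : op_between m M T ->
  form_le (m%:C *: Id) T /\ form_le T (M%:C *: Id).
Proof.
by move=> [_ h]; split=> x; have /andP[] := h x; rewrite bopZE bop1E rdotZl.
Qed.

(** Monotonicity against the scalar means [m # m = m] and [M # M = M]. *)
Lemma gmean_half_between m M U V : 0 < m -> m <= M -> op_between m M U ->
  op_between m M V ->
  op_between m M (gmean 2^-1 U V).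
Proof.
move=> m0 mM hU hV; have M0 := lt_le_trans m0 mM.
have [u [v [u0 uv hX]]] := @gmean_bounds 2^-1 _ _ _ _ m0 mM m0 mM.
have [sX _] := hX _ _ hU hV; split=> // x.
have hm := between_le (lexx _) mM (between_scalar m).
have hM := between_le mM (lexx _) (between_scalar M).
have [U1 U2] := between_form_le hU; have [V1 V2] := between_form_le hV.
have := gmean_half_mono m0 mM m0 mM hm hm hU hV U1 V1 x.
have := gmean_half_mono m0 mM m0 mM hU hV hM hM U2 V2 x.
by rewrite !gmean_half_scalar// !bopZE !bop1E !rdotZl => -> ->.
Qed.

Lemma gmean0 c d a b A B : 0 < c -> c <= d -> 0 < a -> a <= b ->
  op_between c d A -> op_between a b B -> gmean 0 A B = A.
Proof.
move=> c0 cd a0 ab hA hB; have [k0 kl] := conj_bounds_gt0 c0 cd a0 ab.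
have hC := conj_bounds c0 cd a0 ab hA hB.
by have [_ _ _ _ [SS _]] := op_pow_half c0 hA; rewrite gmeanE (op_pow0 k0 hC) mulr1.
Qed.

Lemma gmean1 c d a b A B : 0 < c -> c <= d -> 0 < a -> a <= b ->
  op_between c d A -> op_between a b B -> gmean 1 A B = B.
Proof.
move=> c0 cd a0 ab hA hB; have [k0 kl] := conj_bounds_gt0 c0 cd a0 ab.
have hC := conj_bounds c0 cd a0 ab hA hB.
have [_ _ SP PS _] := op_pow_half c0 hA; rewrite gmeanE (op_pow1 k0 hC).
exact: conjK.
Qed.

(** The square root of [S C^s S] has no direct expression in [S] and [C], so the mean is recognized
    by its Riccati equation, where only the inverse [P C^(-s) P] occurs. *)
Lemma gmean_midpoint c d a b A B s t : 0 < c -> c <= d -> 0 < a -> a <= b ->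
  op_between c d A -> op_between a b B ->
  gmean 2^-1 (gmean s A B) (gmean t A B) = gmean ((s + t) / 2) A B.
Proof.
move=> c0 cd a0 ab hA hB; have [k0 kl] := conj_bounds_gt0 c0 cd a0 ab.
have hC := conj_bounds c0 cd a0 ab hA hB.
have [_ _ SP PS _] := op_pow_half c0 hA.
have [u [v [u0 uv hs]]] := @gmean_bounds s _ _ _ _ c0 cd a0 ab.
have [u' [v' [u'0 uv' ht]]] := @gmean_bounds t _ _ _ _ c0 cd a0 ab.
have [w [z [w0 _ hr]]] := @gmean_bounds ((s + t) / 2) _ _ _ _ c0 cd a0 ab.
have hr' := hr _ _ hA hB.
have hrE := gmeanE ((s + t) / 2) A B.
move: (gmean ((s + t) / 2) A B) hr' hrE => X hX XE.
move: (gmean s A B) (gmeanE s A B) (hs _ _ hA hB) => U UE hU.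
move: (gmean t A B) (gmeanE t A B) (ht _ _ hA hB) => V VE hV.
move: (op_pow 2^-1 A) (op_pow (- 2^-1) A) SP PS hC XE UE VE => S P SP PS.
move: (P * B * P) => C hC XE UE VE.
have hP r r' : op_pow r C * op_pow r' C = op_pow (r + r') C := op_powD _ _ k0 hC.
have hP0 := op_pow0 k0 hC.
have X0 := form_le0_between (ltW w0) hX.
apply: (gmean_half_unique (G :=
  P * op_pow (- s) C * P) u0 uv u'0 uv' hU hV hX.1 X0).
  by rewrite UE (conj_mul2 PS) hP addNr hP0 mulr1.
have e : (s + t) / 2 + - s + (s + t) / 2 = t by field.
by rewrite XE VE (conj_mul3 SP PS) hP hP e.
Qed.

End GeometricMean.

(** * Continuity of geometric means *)

Section UniformContinuity.
Context {R : realType} {H : hilbertType R}.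
Local Notation Id := (1 : bop H).
Implicit Types (A B K X J : bop H) (F G : R -> bop H) (a b c d e m M s t : R).

Definition ucont01 F := forall e, 0 < e -> exists2 d : R, 0 < d &
  forall s t, 0 <= s <= 1 -> 0 <= t <= 1 -> `|s - t| < d -> opnorm (F s - F t) <= e.

Lemma ucont_eq F G : (forall t, F t = G t) -> ucont01 F -> ucont01 G.
Proof. by move=> /funext ->. Qed.

Lemma ucontM F G (k : R) : (forall t, 0 <= t <= 1 -> opnorm (F t) <= k) ->
  (forall t, 0 <= t <= 1 -> opnorm (G t) <= k) -> ucont01 F -> ucont01 G ->
  ucont01 (fun t => F t * G t).
Proof.
move=> Fk Gk uF uG e e0.
have k0 : 0 <= k by apply: le_trans (opnorm_ge0 (F 0)) (Fk 0 _); rewrite lexx ler01.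
have k1 : 0 < k + 1 by rewrite ltr_wpDl.
have e1 : 0 < e / 2 / (k + 1) by rewrite !divr_gt0.
have [d d0 hd] := uF _ e1; have [d' d'0 hd'] := uG _ e1.
exists (Num.min d d'); first by rewrite lt_min d0.
move=> s t s01 t01; rewrite lt_min => /andP[h1 h2].
have -> : F s * G s - F t * G t = (F s - F t) * G s + F t * (G s - G t).
  by rewrite mulrBl mulrBr addrA subrK.
have e2 : e / 2 / (k + 1) * k <= e / 2.
  by rewrite mulrAC ler_pdivrMr// ler_wpM2l ?ltW ?divr_gt0// ltrDl.
rewrite (le_trans (opnorm_tri _ _))// [leRHS]splitr lerD//.
  rewrite (le_trans (opnormM _ _))// (le_trans _ e2)//.
  by apply: ler_pM; rewrite ?opnorm_ge0// ?hd// Gk.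
rewrite (le_trans (opnormM _ _))// (le_trans _ e2)// mulrC.
by apply: ler_pM; rewrite ?opnorm_ge0// ?hd'// Fk.
Qed.

Lemma ucont_rev F : ucont01 F -> ucont01 (fun t => F (1 - t)).
Proof.
move=> uF e /uF[d d0 hd]; exists d => // s t /andP[s0 s1] /andP[t0 t1] st.
apply: hd; [by apply/andP; split; lra|by apply/andP; split; lra|].
by rewrite distrC (_ : 1 - t - (1 - s) = s - t)//; ring.
Qed.

Lemma ucont_cfc a b (f : R -> R) F : {within `[a, b], continuous f} ->
  (forall t, 0 <= t <= 1 -> op_between a b (F t)) -> ucont01 F ->
    ucont01 (fun t => cfc f (F t)).
Proof.
move=> fc hF uF e e0; have [d d0 hd] := cfc_cont (H := H) fc e0.
have [r r0 hr] := uF _ d0; exists r => // s t s01 t01 st.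
by apply: hd; [exact: hF|exact: hF|exact: hr].
Qed.

Lemma ucont_pw c d r F : 0 < c -> (forall t, 0 <= t <= 1 -> op_between c d (F t)) ->
  ucont01 F -> ucont01 (fun t => op_pow r (F t)).
Proof.
move=> c0 hF uF; apply: (@ucont_eq (fun t => cfc (fun x : R => x `^ r) (F t))).
  by move=> t; rewrite op_powE.
by apply: ucont_cfc hF uF; exact: powR_cont.
Qed.

Lemma ucont_conj F G a b c d : (forall t, 0 <= t <= 1 -> op_between a b (F t)) ->
  (forall t, 0 <= t <= 1 -> op_between c d (G t)) -> ucont01 F -> ucont01 G ->
  ucont01 (fun t => F t * G t * F t).
Proof.
move=> hF hG uF uG.
pose k := Num.max (`|a| + `|b|) (`|c| + `|d|).
have kF t : 0 <= t <= 1 -> opnorm (F t) <= k.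
  by move=> t01; rewrite le_max (between_opnorm_le (hF t t01)).
have kG t : 0 <= t <= 1 -> opnorm (G t) <= k.
  by move=> t01; rewrite le_max (between_opnorm_le (hG t t01)) orbT.
have uFG := ucontM kF kG uF uG.
have k0 : 0 <= k by rewrite le_max addr_ge0.
apply: (@ucontM _ _ (Num.max k (k * k))) uFG uF => t t01.
  rewrite le_max (le_trans (opnormM _ _) (_ : _ <= k * k)) ?orbT//.
  by apply: ler_pM; rewrite ?opnorm_ge0 ?kF ?kG.
by rewrite le_max kF.
Qed.

Lemma ucont_gmean_weight c d a b A B : 0 < c -> c <= d -> 0 < a -> a <= b ->
  op_between c d A -> op_between a b B -> ucont01 (fun t => gmean t A B).
Proof.
move=> c0 cd a0 ab hA hB; have [k0 kl] := conj_bounds_gt0 c0 cd a0 ab.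
have hC := conj_bounds c0 cd a0 ab hA hB.
apply: (@ucont_eq (fun t => op_pow 2^-1 A * op_pow t (op_pow (- 2^-1) A * B *
  op_pow (- 2^-1) A) * op_pow 2^-1 A)).
  by move=> t; rewrite gmeanE.
move: (op_pow (- 2^-1) A * B * _) hC => C hC.
have [u [v [u0 uv hS]]] := @op_pow_bounds R H 2^-1 _ _ c0 cd.
move=> e e0; pose k := opnorm (op_pow 2^-1 A) + 1.
have kk : 0 < k by rewrite ltr_wpDl// opnorm_ge0.
have [r r0 hr] := @op_pow_cont R H _ _ k0 kl (e / (k *
  k)) (divr_gt0 e0 (mulr_gt0 kk kk)).
exists r => // s t s01 t01 st; rewrite -mulrBl -mulrBr.
have h := hr s t C s01 t01 st hC.
have Sk : opnorm (op_pow 2^-1 A) <= k by rewrite lerDl.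
rewrite (le_trans (opnormM _ _))//.
rewrite (@le_trans _ _ (k * (e / (k * k)) * k))//; last first.
  rewrite le_eqVlt; apply/orP; left; apply/eqP; field.
  by rewrite gt_eqF.
apply: ler_pM; rewrite ?opnorm_ge0//.
rewrite (le_trans (opnormM _ _))//; apply: ler_pM; rewrite ?opnorm_ge0//.
Qed.

(** Here the exponent is fixed and the operators move: continuity of the functional calculus in the
    operator is applied to each of the three powers in the mean. *)
Lemma ucont_gmean_half c d a b F G : 0 < c -> c <= d -> 0 < a -> a <= b ->
  (forall t, 0 <= t <= 1 -> op_between c d (F t)) -> (forall t, 0 <= t <= 1 ->
    op_between a b (G t)) ->
  ucont01 F -> ucont01 G -> ucont01 (fun t => gmean 2^-1 (F t) (G t)).
Proof.
move=> c0 cd a0 ab hF hG uF uG; have [k0 kl] := conj_bounds_gt0 c0 cd a0 ab.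
apply: (@ucont_eq (fun t => op_pow 2^-1 (F t) *
  op_pow 2^-1 (op_pow (- 2^-1) (F t) * G t * op_pow (- 2^-1) (F t)) *
  op_pow 2^-1 (F t))).
  by move=> t; rewrite gmeanE.
have [u [v [_ _ hS]]] := @op_pow_bounds R H 2^-1 _ _ c0 cd.
have [u' [v' [_ _ hP]]] := @op_pow_bounds R H (- 2^-1) _ _ c0 cd.
have [w [z [_ _ hD]]] := @op_pow_bounds R H 2^-1 _ _ k0 kl.
have hC t : 0 <= t <= 1 -> op_between (a * d^-1) (b *
  c^-1) (op_pow (- 2^-1) (F t) * G t * op_pow (- 2^-1) (F t)).
  by move=> t01; exact: (conj_bounds c0 cd a0 ab (hF t t01) (hG t t01)).
apply: (@ucont_conj _ _ u v w z).
- by move=> t t01; exact: hS (hF t t01).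
- by move=> t t01; exact: hD (hC t t01).
- exact: ucont_pw c0 hF uF.
apply: ucont_pw k0 hC _.
apply: (@ucont_conj _ _ u' v' a b) => //.
- by move=> t t01; exact: hP (hF t t01).
exact: ucont_pw c0 hF uF.
Qed.

Lemma gmean_between m M A B t : 0 < m -> m <= M -> op_between m M A ->
  op_between m M B ->
  0 <= t <= 1 -> op_between m M (gmean t A B).
Proof.
move=> m0 mM hA hB /andP[t0 t1].
have dyadic n k : (k <= 2 ^ n)%N -> op_between m M (gmean (k%:R / 2 ^+ n) A B).
  elim: n k => [|n IH] k.
    rewrite expr0 divr1; case: k => [_|[_|//]].
      by rewrite (gmean0 m0 mM m0 mM hA hB).
    by rewrite (gmean1 m0 mM m0 mM hA hB).
  move=> kn; have [j kj] : exists j, (k = j.*2 \/ k = j.*2.+1).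
    exists k./2; rewrite -{1 3}(odd_double_half k).
    by case: (odd k); [right; rewrite add1n|left; rewrite add0n].
  have n2 : (2 ^ n.+1 = (2 ^ n).*2)%N by rewrite expnS mul2n.
  have P0 : 2 ^+ n != 0 :> R by rewrite expf_neq0// pnatr_eq0.
  (* An even numerator reduces to level [n]; an odd one [2 j + 1] gives the midpoint of [j / 2^n]
     and [(j + 1) / 2^n]. *)
  case: kj => kj.
    have -> : k%:R / 2 ^+ n.+1 = j%:R / 2 ^+ n :> R.
      by rewrite kj -mul2n natrM exprS; field.
    by apply: IH; move: kn; rewrite kj n2 leq_double.
  have jn : (j.+1 <= 2 ^ n)%N by move: kn; rewrite kj n2 ltn_double.
  have -> : k%:R / 2 ^+ n.+1 = (j%:R / 2 ^+ n + j.+1%:R / 2 ^+ n) / 2 :> R.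
    by rewrite kj -natr1 -mul2n natrM exprS -natr1; field.
  rewrite -(gmean_midpoint _ _ m0 mM m0 mM hA hB).
  by apply: (gmean_half_between m0 mM); apply: IH => //; exact: ltnW.
apply: between_closed => e e0.
have [d d0 hd] := ucont_gmean_weight m0 mM m0 mM hA hB e0.
have [N hN] : exists N, forall n, (N <= n)%N -> 2^-1 ^+ n <= d / 2.
  by apply: geometric_to0; [apply/andP; split; lra|exact: divr_gt0].
pose k := Num.truncn (t * 2 ^+ N).
have P0 : 0 < 2 ^+ N :> R by rewrite exprn_gt0.
have /andP[k1 k2] : k%:R <= t * 2 ^+ N < k.+1%:R.
  by apply: truncn_itv; rewrite mulr_ge0// ltW.
have kN : (k <= 2 ^ N)%N.
  by rewrite -(ler_nat R) natrX (le_trans k1)// ler_piMl// ltW.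
exists (gmean (k%:R / 2 ^+ N) A B).
  by apply: between_le (dyadic N k kN); lra.
apply: hd; first by rewrite t0.
  apply/andP; split; first by rewrite divr_ge0 ?ler0n ?ltW.
  by rewrite ler_pdivrMr// mul1r -natrX ler_nat.
apply: le_lt_trans (_ : d / 2 < d); last by lra.
apply: le_trans (hN N (leqnn N)).
have h1 : k%:R / 2 ^+ N <= t by rewrite ler_pdivrMr.
rewrite ger0_norm ?subr_ge0// lerBlDl exprVn.
by rewrite -(ler_pM2r P0) mulrDl divfK ?gt_eqF// mulVf ?gt_eqF// natr1 ltW.
Qed.

End UniformContinuity.

(** * The Riemann integral *)

Section RiemannExistence.
Context {R : realType} {H : hilbertType R}.
Implicit Types (K X J : bop H) (F G : R -> bop H) (d e : R) (p q : nat -> R).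
Implicit Types (s : seq R) (xi : nat -> R).

Lemma opnorm_sum n (G : 'I_n ->
  bop H) : opnorm (\sum_(i < n) G i) <= \sum_(i < n) opnorm (G i).
Proof.
elim/big_ind2 : _ => //; first by rewrite opnorm0.
by move=> S a T b h1 h2; rewrite (le_trans (opnorm_tri _ _))// lerD.
Qed.

(* Length of the intersection of the intervals from [p k] to [p k.+1] and from
   [q l] to [q l.+1]. *)
Definition overlap p q k l : R :=
  (Num.min (p k.+1) (q l.+1) - Num.min (p k.+1) (q l)) -
  (Num.min (p k) (q l.+1) - Num.min (p k) (q l)).

Lemma overlapC p q k l : overlap p q k l = overlap q p l k.
Proof.
rewrite /overlap !(minC (p _));
  move: (Num.min _ _) (Num.min _ _) (Num.min _ _) (Num.min _ _).
by move=> *; ring.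
Qed.

Lemma sum_increments p n : \sum_(l < n) (p l.+1 - p l) = p n - p 0%N.
Proof. by rewrite -(big_mkord xpredT (fun l => p l.+1 - p l)) telescope_sumr. Qed.

(** [overlap] is a mixed second difference of the minimum, so the sum over [l] telescopes; the
    hypotheses place both ends of the interval of [p] within the range of [q]. *)
Lemma sum_overlap p q k n : q 0%N <= p k -> q 0%N <= p k.+1 -> p k <= q n ->
  p k.+1 <= q n ->
  \sum_(l < n) overlap p q k l = p k.+1 - p k.
Proof.
move=> h1 h2 h3 h4.
have := sum_increments (fun l => Num.min (p k.+1) (q l) - Num.min (p k) (q l)) n.
rewrite (min_l h3) (min_l h4) (min_r h1) (min_r h2) => e.
transitivity (p k.+1 - p k - (q 0%N - q 0%N)); last by rewrite subrr subr0.
by rewrite -e; apply: eq_bigr => l _; rewrite /overlap; ring.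
Qed.

Lemma overlap_ge0 p q k l : p k <= p k.+1 -> q l <= q l.+1 -> 0 <= overlap p q k l.
Proof.
rewrite /overlap /Num.min => h1 h2.
by case: ltP => ?; case: ltP => ?; case: ltP => ?; case: ltP => ?; lra.
Qed.

Lemma overlap_neq0 p q k l : p k <= p k.+1 -> q l <= q l.+1 ->
  overlap p q k l != 0 ->
  p k < q l.+1 /\ q l < p k.+1.
Proof.
rewrite /overlap /Num.min => h1 h2 h.
by split; rewrite ltNge; apply: contra h => h; apply/eqP;
  case: ltP => ?; case: ltP => ?; case: ltP => ?; case: ltP => ?; lra.
Qed.

(** A partition list omits its left endpoint; restoring [s_0 = 0] shifts the index, so
    [knots s k.+1] is [nth 0 s k]. *)
Definition knots (s : seq R) k : R := nth 0 (0 :: s) k.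

Lemma itv_partition_mono s : itv_partition 0 1 s ->
  [/\ knots s 0 = 0, knots s (size s) = 1,
     forall k, (k < size s)%N -> knots s k <= knots s k.+1 &
     forall k, (k <= size s)%N -> 0 <= knots s k <= 1].
Proof.
move=> [ps /eqP ls]; have k1 :
  knots s (size s) = 1 by rewrite /knots -[size s]/((size (0 :: s)).-1) nth_last.
have mono k : (k < size s)%N -> knots s k <= knots s k.+1.
  by move=> ks; apply/ltW; move/(pathP 0): ps => /(_ k ks).
split=> // k ks; apply/andP; split.
  elim: k ks => [|k IH] ks; first by [].
  by rewrite (le_trans (IH (ltnW ks)))// mono.
rewrite -k1 -(subnK ks) addnC; move: (size s - k)%N (subnKC ks) => n.
elim: n => [|n IH] in k ks *; first by rewrite addn0.
move=> e; have kn : (k < size s)%N by rewrite -e addnS ltnS leq_addr.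
rewrite (le_trans (mono k kn))// addnS -addSn; apply: IH => //.
by rewrite addSn -addnS.
Qed.

Lemma riemann_sumE F s xi : riemann_sum F 0 s xi =
  \sum_(k < size s) (knots s k.+1 - knots s k)%:C *: F (xi k).
Proof. by []. Qed.

Lemma tagged01 s xi k : itv_partition 0 1 s -> Defs.tagged 0 s xi ->
  (k < size s)%N ->
  0 <= xi k <= 1.
Proof.
move=> hs ht ks; have [_ _ _ h] := itv_partition_mono hs.
have /andP[h1 h2] := ht k ks.
have /andP[h3 _] := h k (ltnW ks); have /andP[_ h4] := h k.+1 ks.
by rewrite (le_trans h3)//= (le_trans h2).
Qed.

(* Both sums are rewritten as double sums weighted by the overlaps of the two
   partitions, which avoids constructing a common refinement. *)
Lemma riemann_sum_dist F d e s xi s' xi' : 0 <= e ->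
  (forall x y, 0 <= x <= 1 -> 0 <= y <= 1 -> `|x - y| < d ->
    opnorm (F x - F y) <= e) ->
  itv_partition 0 1 s -> Defs.tagged 0 s xi ->
  (forall k, (k < size s)%N -> knots s k.+1 - knots s k < d / 2) ->
  itv_partition 0 1 s' -> Defs.tagged 0 s' xi' ->
  (forall k, (k < size s')%N -> knots s' k.+1 - knots s' k < d / 2) ->
  opnorm (riemann_sum F 0 s xi - riemann_sum F 0 s' xi') <= e.
Proof.
move=> e0 uF hs ht md hs' ht' md'; rewrite !riemann_sumE.
have [p0 pn pm p01] := itv_partition_mono hs.
have [q0 qn qm q01] := itv_partition_mono hs'.
set p := knots s in p0 pn pm p01 md *; set q := knots s' in q0 qn qm q01 md' *.
set n := size s in pn pm p01 md *; set n' := size s' in qn qm q01 md' *.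
have sum1 k : (k < n)%N -> \sum_(l < n') overlap p q k l = p k.+1 - p k.
  move=> kn; have /andP[? ?] := p01 k (ltnW kn); have /andP[? ?] := p01 _ kn.
  by apply: sum_overlap; rewrite ?q0 ?qn.
have sum2 l : (l < n')%N -> \sum_(k < n) overlap p q k l = q l.+1 - q l.
  move=> ln; have /andP[? ?] := q01 l (ltnW ln); have /andP[? ?] := q01 _ ln.
  under eq_bigr do rewrite overlapC.
  by apply: sum_overlap; rewrite ?p0 ?pn.
have -> : \sum_(k < n) (p k.+1 - p k)%:C *: F (xi k) - \sum_(k < n') (q k.+1 - q
  k)%:C *: F (xi' k) =
   \sum_(k < n) \sum_(l < n') (overlap p q k l)%:C *: (F (xi k) - F (xi' l)).
  have -> : \sum_(k < n) (p k.+1 - p k)%:C *: F (xi k) =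
      \sum_(k < n) \sum_(l < n') (overlap p q k l)%:C *: F (xi k).
    by apply: eq_bigr => k _; rewrite -scaler_suml -rmorph_sum /= sum1.
  have -> : \sum_(k < n') (q k.+1 - q k)%:C *: F (xi' k) =
      \sum_(k < n) \sum_(l < n') (overlap p q k l)%:C *: F (xi' l).
    rewrite exchange_big; apply: eq_bigr => l _.
    by rewrite -scaler_suml -rmorph_sum /= sum2.
  rewrite -sumrB; apply: eq_bigr => k _; rewrite -sumrB; apply: eq_bigr => l _.
  by rewrite scalerBr.
have -> : e = \sum_(k < n) \sum_(l < n') overlap p q k l * e.
  transitivity (\sum_(k < n) (p k.+1 - p k) * e).
    by rewrite -mulr_suml sum_increments p0 pn subr0 mul1r.
  by apply: eq_bigr => k _; rewrite -mulr_suml sum1.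
rewrite (le_trans (opnorm_sum _))//; apply: ler_sum => k _.
rewrite (le_trans (opnorm_sum _))//; apply: ler_sum => l _.
have kn := ltn_ord k; have ln := ltn_ord l.
have w0 := overlap_ge0 (pm _ kn) (qm _ ln).
rewrite opnormZr ger0_norm//.
have [->|w1] := eqVneq (overlap p q k l) 0; first by rewrite !mul0r.
apply: ler_wpM2l => //; apply: uF;
  [exact: tagged01 hs ht kn|exact: tagged01 hs' ht' ln|].
(* The two subintervals meet and each is shorter than [d / 2], so their tags are less than [d]
   apart. *)
have [pq qp] := overlap_neq0 (pm _ kn) (qm _ ln) w1.
have := md _ kn; have := md' _ ln.
have : p k <= xi k <= p k.+1 := ht k kn.
have : q l <= xi' l <= q l.+1 := ht' l ln.
move=> /andP[? ?] /andP[? ?] ? ?; rewrite ltr_norml; apply/andP; split; lra.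
Qed.

Definition unif_part n : seq R := mkseq (fun k => k.+1%:R / n.+1%:R) n.+1.

Lemma knots_unif n k : (k <= n.+1)%N -> knots (unif_part n) k = k%:R / n.+1%:R.
Proof.
by case: k => [|k] kn; rewrite /knots /= ?mul0r// nth_mkseq.
Qed.

Lemma unif_partP n : itv_partition 0 1 (unif_part n).
Proof.
split.
  apply/(pathP 0) => k; rewrite size_mkseq => kn.
  rewrite -[nth 0 (0 :: _) k]/(knots (unif_part n) k) -[nth 0 _ k]/(knots
    (unif_part n) k.+1).
  by rewrite !knots_unif// 1?ltnW// ltr_pM2r ?invr_gt0 ?ltr0n// ltr_nat.
by rewrite -nth_last size_mkseq nth_mkseq//= divff// pnatr_eq0.
Qed.

Definition unif_tag n k : R := k%:R / n.+1%:R.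

Lemma unif_tagged n : Defs.tagged 0 (unif_part n) (unif_tag n).
Proof.
move=> k; rewrite size_mkseq => kn.
rewrite -[nth 0 (0 :: _) k]/(knots (unif_part n) k) -[nth 0 _ k]/(knots
  (unif_part n) k.+1).
rewrite !knots_unif// 1?ltnW// lexx /=.
by rewrite ler_pM2r ?invr_gt0 ?ltr0n// ler_nat.
Qed.

Lemma unif_mesh n k : (k < size (unif_part n))%N ->
  knots (unif_part n) k.+1 - knots (unif_part n) k = n.+1%:R^-1.
Proof.
rewrite size_mkseq => kn; rewrite !knots_unif// 1?ltnW//.
by rewrite -mulrBl -natr1 addrAC subrr add0r mul1r.
Qed.

Lemma inv_nat_small (d : R) : 0 < d -> exists N, forall n, (N <= n)%N ->
  n.+1%:R^-1 < d.
Proof.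
move=> d0; exists (Num.truncn d^-1) => n Nn.
rewrite -[d]invrK ltf_pV2 ?posrE ?invr_gt0// ?ltr0n//.
by apply: lt_le_trans (truncnS_gt _) _; rewrite ler_nat ltnS.
Qed.

(** The value is the limit along uniform partitions; every other fine Riemann sum is compared with a
    uniform one. *)
Lemma ucont_is_rint F : ucont01 F -> exists J, is_rint F 0 1 J.
Proof.
move=> uF; pose S n := riemann_sum F 0 (unif_part n) (unif_tag n).
have [J hJ] : exists J, op_cvg S J.
  apply: bop_complete => e e0; have [d d0 hd] := uF _ e0.
  have d2 : 0 < d / 2 by rewrite divr_gt0.
  have [N hN] := inv_nat_small d2; exists N => m n Nm Nn.
  apply: (riemann_sum_dist (ltW e0) hd (unif_partP m) (@unif_tagged m) _
    (unif_partP n) (@unif_tagged n)).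
    by move=> k km; rewrite unif_mesh// hN.
  by move=> k kn; rewrite unif_mesh// hN.
exists J => e e0; have e2 : 0 < e / 2 by rewrite divr_gt0.
have [d d0 hd] := uF _ e2; have d2 : 0 < d / 2 by rewrite divr_gt0.
exists (d / 2) => // s xi hs ht mesh; rewrite /Num.norm /= lecR.
have [N hN] := inv_nat_small d2; have [N' hN'] := hJ _ e2.
pose n := maxn N N'.
have h1 : opnorm (riemann_sum F 0 s xi - S n) <= e / 2.
  apply: (riemann_sum_dist (ltW e2) hd hs ht mesh (unif_partP n) (@unif_tagged n)).
  by move=> k kn; rewrite unif_mesh// hN// leq_maxl.
have h2 : opnorm (S n - J) <= e / 2 by rewrite hN'// leq_maxr.
rewrite (_ : _ - J = (riemann_sum F 0 s xi - S n) + (S n - J));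
  last by rewrite addrA subrK.
by rewrite (le_trans (opnorm_tri _ _))// [leRHS]splitr lerD.
Qed.

Lemma rintP F : ucont01 F -> is_rint F 0 1 (rint F 0 1).
Proof. by move=> /ucont_is_rint h; rewrite /rint; apply: xgetPex. Qed.

Lemma rint_approx F e : ucont01 F -> 0 < e ->
  exists n, opnorm (riemann_sum F 0 (unif_part n) (unif_tag n) - rint F 0 1) <= e.
Proof.
move=> /rintP hJ e0; have [d d0 hd] := hJ e e0.
have [N hN] := inv_nat_small d0; exists N.
have := hd _ _ (unif_partP N) (@unif_tagged N).
rewrite /Num.norm /= lecR; apply => k kN.
by have := unif_mesh kN; rewrite /knots /= => ->; exact: hN.
Qed.

Lemma riemann_sum_qf F n x : rdot (riemann_sum F 0 (unif_part n) (unif_tag n) x) x =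
  \sum_(k < n.+1) n.+1%:R^-1 * rdot (F (unif_tag n k) x) x.
Proof.
rewrite riemann_sumE.
have sE m (G : 'I_m -> bop H) :
  rdot ((\sum_(k < m) G k) x) x = \sum_(k < m) rdot (G k x) x.
  elim/big_ind2 : _ => //; first by rewrite bop0E rdot0l.
  by move=> S a T b h1 h2; rewrite bopDE rdotDl h1 h2.
rewrite sE size_mkseq; apply: eq_bigr => k _.
by rewrite unif_mesh ?size_mkseq// bopZE rdotZl.
Qed.

Lemma unif_tag01 n k : (k < n.+1)%N -> 0 <= unif_tag n k <= 1.
Proof.
move=> kn; apply: (tagged01 (unif_partP n) (@unif_tagged n)); by rewrite size_mkseq.
Qed.

Lemma rint_sym F : ucont01 F -> (forall t, 0 <= t <= 1 -> op_sym (F t)) ->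
  op_sym (rint F 0 1).
Proof.
move=> uF sF; apply: sym_closed => e e0; have [n hn] := rint_approx uF e0.
exists (riemann_sum F 0 (unif_part n) (unif_tag n)); last by rewrite -opnormN opprB.
rewrite riemann_sumE; elim/big_ind : _ => [|S T|k _]; [exact: sym0|exact: symD|].
apply: symZ; apply: sF; apply: unif_tag01.
by apply: leq_trans (ltn_ord k) _; rewrite size_mkseq.
Qed.

Lemma rint_form_le_ub F K : ucont01 F -> (forall t, 0 <= t <= 1 ->
  form_le (F t) K) ->
  form_le (rint F 0 1) K.
Proof.
move=> uF FK x; rewrite -subr_le0; apply: (@le0_of_small _ _ (2 * rdot x x)).
  by rewrite mulr_ge0 ?rdot_ge0.
move=> e e0; have [n hn] := rint_approx uF e0.
have := rdot_small x x e0 hn; rewrite bopDE bopNE rdotDl rdotNl riemann_sum_qf.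
have : \sum_(k < n.+1) n.+1%:R^-1 * rdot (F (unif_tag n k) x) x <= rdot (K x) x.
  have -> : rdot (K x) x = \sum_(k < n.+1) n.+1%:R^-1 * rdot (K x) x.
    by rewrite sumr_const card_ord -[RHS]mulr_natl mulrA divff ?mul1r// pnatr_eq0.
  apply: ler_sum => k _; rewrite ler_wpM2l ?invr_ge0// FK// unif_tag01//.
move: (\sum_(k < n.+1) _) (rdot (K x) x) (rdot _ x) (rdot x x) => a b c d.
by rewrite ler_norml; lra.
Qed.

Lemma rint_form_le_lb F K : ucont01 F -> (forall t, 0 <= t <= 1 ->
  form_le K (F t)) ->
  form_le K (rint F 0 1).
Proof.
move=> uF FK x; rewrite -subr_le0; apply: (@le0_of_small _ _ (2 * rdot x x)).
  by rewrite mulr_ge0 ?rdot_ge0.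
move=> e e0; have [n hn] := rint_approx uF e0.
have := rdot_small x x e0 hn; rewrite bopDE bopNE rdotDl rdotNl riemann_sum_qf.
have : rdot (K x) x <= \sum_(k < n.+1) n.+1%:R^-1 * rdot (F (unif_tag n k) x) x.
  have -> : rdot (K x) x = \sum_(k < n.+1) n.+1%:R^-1 * rdot (K x) x.
    by rewrite sumr_const card_ord -[RHS]mulr_natl mulrA divff ?mul1r// pnatr_eq0.
  apply: ler_sum => k _; rewrite ler_wpM2l ?invr_ge0// FK// unif_tag01//.
move: (\sum_(k < n.+1) _) (rdot (K x) x) (rdot _ x) (rdot x x) => a b c d.
by rewrite ler_norml; lra.
Qed.

End RiemannExistence.

(** * Bounds on the spectrum *)

Section SpectralBounds.
Context {R : realType} {H : hilbertType R}.
Implicit Types (A T : bop H) (I : interval R) (m M : R).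

(** Positivity in [R[i]] includes reality of the form, from which [op_leP] extracts symmetry. *)
Lemma strictly_positive_sym A : strictly_positive A -> op_sym A.
Proof.
move=> pA; have /op_leP[sA _] : op_le 0 A.
  move=> x; rewrite subr0; have [->|x0] := eqVneq x 0; last exact: ltW (pA x x0).
  by rewrite bop0 hdot_norm normr0 expr0n.
by move: sA; rewrite subr0.
Qed.

Lemma between_strictly_positive m M T : 0 < m -> op_between m M T ->
  strictly_positive T.
Proof.
move=> m0 hT x x0; have /op_leP/(_ x) : op_sym (T - 0) /\ form_le 0 T.
  by rewrite subr0; split; [exact: hT.1|exact: form_le0_between (ltW m0) hT].
rewrite subr0 lecE ltcE => /andP[-> _] /=.
have /andP[h _] := hT.2 x; apply: lt_le_trans h.
by rewrite mulr_gt0// rdot_gt0.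
Qed.

Lemma spectrumN T (z : R[i]) : op_spectrum (- T) z -> op_spectrum T (- z).
Proof.
move=> hz hT; apply: hz; rewrite -[- T - _]opprD; apply: invertibleN.
by move: hT; rewrite scaleNr opprK.
Qed.

(** Both extremes of the form are spectral points, the upper one through [- T]. They therefore lie
    in [I] itself, even when [I] is open. *)
Lemma spectrum_in_between I T : op_sym T -> (exists x : H, x != 0) ->
  spectrum_in I T ->
  exists m M, [/\ m \in I, M \in I, m <= M & op_between m M T].
Proof.
move=> sT [x0 x00] hI.
have [m [m1 m2]] := sym_inf sT (ex_intro _ x0 x00).
have [M [M1 M2]] := sym_inf (symN sT) (ex_intro _ x0 x00).
have [m' mI /complexI mE] := hI _ (inf_spectrum sT m1 m2).
have [M' MI] := hI _ (spectrumN (inf_spectrum (symN sT) M1 M2)).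
rewrite -rmorphN => /complexI ME.
have hT : op_between m (- M) T.
  split=> // x; rewrite m1 /=; have := M1 x; rewrite bopNE rdotNl; lra.
exists m, (- M); split=> //; [by rewrite -mE|by rewrite -ME|].
have /andP[h1 h2] := hT.2 x0.
by rewrite -(ler_pM2r (rdot_gt0 x00)) (le_trans h1).
Qed.

Lemma between_spectrum_in I m M T : {subset `[m, M] <= I} -> op_between m M T ->
  spectrum_in I T.
Proof.
move=> mMI hT z /(between_spectrum hT)[x -> hx]; exists x => //=.
by apply: mMI; rewrite in_itv.
Qed.

End SpectralBounds.

(** * The Hermite-Hadamard inequality for geometric means *)

Theorem theorem2p9 (R : realType) (H : hilbertType R)
    (I : interval R) (f : R -> R) (A B : bop H) :
  (forall x : R, x \in I -> 0 < x) ->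
  op_geom_convex H I f ->
  strictly_positive A -> strictly_positive B ->
  spectrum_in I A -> spectrum_in I B ->
  let J : bop H := rint (fun t : R =>
    gmean 2^-1 (cfc f (gmean t A B)) (cfc f (gmean (1 - t) A B))) 0 1 in
  op_le (cfc f (gmean 2^-1 A B)) J /\
  op_le J (gmean 2^-1 (cfc f A) (cfc f B)).
Proof.
move=> I0 [fc fpos fconv] pA pB IA IB J.
(* On the zero space the spectrum is empty and yields no bounds [m] and [M], but every order
   relation holds. *)
have [H0|Htriv] := pselect (exists x : H, x != 0); last first.
  have triv S T : @op_le R H S T.
    move=> x; have [->|x0] := eqVneq x 0;
      first by rewrite bop0 hdot_norm normr0 expr0n.
    by case: Htriv; exists x.
  by split; exact: triv.
have [mA [MA [mAI MAI mMA hA]]] :=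
  spectrum_in_between (strictly_positive_sym pA) H0 IA.
have [mB [MB [mBI MBI mMB hB]]] :=
  spectrum_in_between (strictly_positive_sym pB) H0 IB.
(* Each of [m] and [M] is one of the four spectral endpoints, so both lie in [I], and by convexity
   of [I] so does [[m, M]]. *)
pose m := Num.min mA mB; pose M := Num.max MA MB.
have mI : m \in I by rewrite /m /Num.min; case: ifP.
have MI : M \in I by rewrite /M /Num.max; case: ifP.
have m0 : 0 < m := I0 _ mI.
have mM : m <= M by rewrite /m /M ge_min le_max mMA.
have {}hA : op_between m M A by apply: between_le hA;
  rewrite ?ge_min ?le_max lexx ?orbT.
have {}hB : op_between m M B by apply: between_le hB;
  rewrite ?ge_min ?le_max lexx ?orbT.
have mMI : {subset `[m, M] <= I}.
  by move=> x; rewrite in_itv => hx; exact: (interval_is_interval mI MI hx).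
have {}fc : {within `[m, M], continuous f}.
  by apply: continuous_subspaceW fc => x /= /mMI.
have [x hx|c [d [c0 cd fcd]]] := continuous_pos_bounds mM fc.
  by apply: fpos; apply: mMI; rewrite in_itv.
pose P t := gmean t A B.
have hP (t : R) : 0 <= t <= 1 -> op_between m M (P t) := gmean_between m0 mM hA hB.
have hfP (T : bop H) : op_between m M T -> op_between c d (cfc f T) by move=> hT;
  exact: cfc_between hT fc fcd.
have rev01 (t : R) : 0 <= t <= 1 -> 0 <= 1 - t <= 1.
  by move=> /andP[t0 t1]; apply/andP; split; lra.
have uP : ucont01 (fun t => cfc f (P t)).
  by apply: (ucont_cfc fc hP); exact: (ucont_gmean_weight m0 mM m0 mM hA hB).
pose F t := gmean 2^-1 (cfc f (P t)) (cfc f (P (1 - t))).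
have uF : ucont01 F.
  apply: (ucont_gmean_half c0 cd c0 cd); [| |exact: uP|exact: (ucont_rev uP)].
    by move=> t t01; exact: hfP (hP t t01).
  by move=> t t01; exact: hfP (hP _ (rev01 t t01)).
have [u [v [u0 uv hgm]]] := @gmean_bounds R H 2^-1 _ _ _ _ c0 cd c0 cd.
have hF (t : R) : 0 <= t <= 1 -> op_between u v (F t).
  move=> t01; apply: hgm; apply: hfP; [exact: hP|exact: hP (rev01 t t01)].
have sJ : op_sym J by apply: rint_sym uF _ => t /hF[].
have half01 : 0 <= (2^-1 : R) <= 1 by apply/andP; split; lra.
have midE (t : R) : (t + (1 - t)) / 2 = 2^-1 :> R by field.
have spI (T : bop H) : op_between m M T ->
  spectrum_in I T by exact: between_spectrum_in.
have sp0 (T : bop H) : op_between m M T ->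
  strictly_positive T by exact: between_strictly_positive.
have hfA := hfP A hA; have hfB := hfP B hB.
split; apply/op_leP; split.
- by apply: symB => //; have [] := hfP _ (hP 2^-1 half01).
- apply: rint_form_le_lb uF _ => t t01; have ht := hP t t01;
  have ht' := hP _ (rev01 t t01).
  have /op_leP[_] := fconv 2^-1 _ _ half01 (sp0 _ ht) (sp0 _ ht') (spI _ ht) (spI
    _ ht').
  by rewrite (gmean_midpoint _ _ m0 mM m0 mM hA hB) midE.
- by apply: symB => //; have [] := hgm _ _ hfA hfB.
apply: rint_form_le_ub uF _ => t t01; have ht := hP t t01;
  have ht' := hP _ (rev01 t t01).
have /op_leP[_ h1] := fconv t _ _ t01 pA pB IA IB.
have /op_leP[_ h2] := fconv (1 - t) _ _ (rev01 t t01) pA pB IA IB.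
rewrite -(midE t) -(gmean_midpoint _ _ c0 cd c0 cd hfA hfB).
(* [gmean_half_mono] compares pairs with common bounds, so the means of [f(A)] and [f(B)] must lie
   in the same [[c, d]] as the values of [f] at the means. *)
have hQ (s : R) : 0 <= s <= 1 ->
  op_between c d (gmean s (cfc f A) (cfc f B)) := gmean_between c0 cd hfA hfB.
exact: (gmean_half_mono c0 cd c0 cd (hfP _ ht) (hfP _ ht') (hQ t t01) (hQ _
  (rev01 t t01)) h1 h2).
Qed.
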